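(* Let $M=r^a$ be a prime power ($r$ prime, $a\geq 1$) and let $q$ be a prime power with $(q,M)=1$. Then, as formal power series in $u$: (1) $$1+\sum_{n=1}^{\infty}c(n,q,M)_{\mathrm{ss}}\,u^n=\prod_{i=0}^{a}\prod_{d\geq 1}\left(1-u^{r^id}\right)^{-N_M^i(q,d)}.$$ (2) $$1+\sum_{n=1}^{\infty}\frac{|\mathrm{GL}(n,q)^M_{\mathrm{ss}}|}{|\mathrm{GL}(n,q)|}u^n=\prod_{i=0}^{a}\prod_{d\geq 1}\left(1+\sum_{j=1}^{\infty}\frac{u^{r^ijd}}{q^{\frac{r^ij(r^ij-1)d}{2}}\prod_{t=1}^{r^ij}(q^{td}-1)}\right)^{N_M^i(q,d)}.$$
   Context: $\mathbb F_q$ is the field with $q$ elements and $\mathrm{GL}(n,q)$ the group of invertible $n\times n$ matrices over it. $\Phi$ is the set of all monic irreducible polynomials of degree $\geq 1$ over $\mathbb F_q$ other than the polynomial $x$. An element $\alpha\in\mathrm{GL}(n,q)$ (and its conjugacy class) is semisimple if the $\mathbb F_q[x]$-module $\mathbb F_q^n$ defined by $\alpha$ is a direct sum of modules $\mathbb F_q[x]/(f)$ with $f\in\Phi$. $c(n,q,M)_{\mathrm{ss}}$ is the number of semisimple conjugacy classes of $\mathrm{GL}(n,q)$ contained in the image of the power map $\mathrm{GL}(n,q)\to\mathrm{GL}(n,q)$, $x\mapsto x^M$, and $\mathrm{GL}(n,q)^M_{\mathrm{ss}}$ is the set of semisimple elements lying in this image. For $M=r^a$: $N_M^0(q,d)$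 is the number of $f\in\Phi$ of degree $d$ such that $f(x^M)$ has an irreducible factor of degree $d$; for $1\leq i\leq a$, $N_M^i(q,d)$ is the number of $f\in\Phi$ of degree $d$ such that all irreducible factors of $f(x^M)$ over $\mathbb F_q$ have degree $dr^i$. *)

(* Defs.v *)
From HB Require Import structures.
From mathcomp Require Import all_boot all_order all_fingroup all_algebra.
From mathcomp Require Import boolp.

Set Implicit Arguments.
Unset Strict Implicit.
Unset Printing Implicit Defensive.

Import GRing.Theory.
Local Open Scope ring_scope.

(* Formal power series over a field: the ring structure is the Cauchy product,
   the units are the series with nonzero constant coefficient. *)

Record fps (R : fieldType) := FPS { coefs : nat -> R }.

Section FPSRing.
Variable R : fieldType.
Implicit Types f g h : fps R.

HB.instance Definition _ := gen_eqMixin (fps R).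
HB.instance Definition _ := gen_choiceMixin (fps R).

Lemma fpsP f g : coefs f =1 coefs g -> f = g.
Proof. by case: f g => [f] [g] /= /funext ->. Qed.

Definition fps_zero : fps R := FPS (fun=> 0).
Definition fps_opp f := FPS (fun n => - coefs f n).
Definition fps_add f g := FPS (fun n => coefs f n + coefs g n).
Definition fps_one : fps R := FPS (fun n => (n == 0%N)%:R).
Definition fps_mul f g :=
  FPS (fun n => \sum_(k < n.+1) coefs f k * coefs g (n - k)).

Fact fps_addA : associative fps_add.
Proof. by move=> f g h; apply: fpsP => n /=; rewrite addrA. Qed.
Fact fps_addC : commutative fps_add.
Proof. by move=> f g; apply: fpsP => n /=; rewrite addrC. Qed.
Fact fps_add0 : left_id fps_zero fps_add.
Proof. by move=> f; apply: fpsP => n /=; rewrite add0r. Qed.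
Fact fps_addN : left_inverse fps_zero fps_opp fps_add.
Proof. by move=> f; apply: fpsP => n /=; rewrite addNr. Qed.

HB.instance Definition _ :=
  GRing.isZmodule.Build (fps R) fps_addA fps_addC fps_add0 fps_addN.

Definition fps_trunc n f : {poly R} := \poly_(i < n) coefs f i.

Lemma coef_fps_trunc n f k : (k < n)%N -> (fps_trunc n f)`_k = coefs f k.
Proof. by move=> ltkn; rewrite coef_poly ltkn. Qed.

Lemma coef_fps_mul n f g k : (k < n)%N ->
  coefs (fps_mul f g) k = (fps_trunc n f * fps_trunc n g)`_k.
Proof.
move=> ltkn; rewrite coefM; apply: eq_bigr => i _.
rewrite !coef_fps_trunc //; first exact: leq_ltn_trans (leq_subr _ _) ltkn.
exact: leq_ltn_trans (leq_ord i) ltkn.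
Qed.

Fact fps_mulA : associative fps_mul.
Proof.
move=> f g h; apply: fpsP => n.
have trM (f1 f2 : fps R) k : (k < n.+1)%N ->
    coefs (fps_mul f1 f2) k = (fps_trunc n.+1 f1 * fps_trunc n.+1 f2)`_k.
  exact: coef_fps_mul.
transitivity ((fps_trunc n.+1 f * (fps_trunc n.+1 g * fps_trunc n.+1 h))`_n).
  rewrite coefM; apply: eq_bigr => i _.
  by rewrite trM ?ltnS ?leq_subr // coef_fps_trunc.
rewrite mulrA coefM; apply: eq_bigr => i _.
by rewrite trM // coef_fps_trunc // ltnS leq_subr.
Qed.

Fact fps_mulC : commutative fps_mul.
Proof.
by move=> f g; apply: fpsP => n; rewrite !(@coef_fps_mul n.+1) // mulrC.
Qed.

Fact fps_mul1 : left_id fps_one fps_mul.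
Proof.
move=> f; apply: fpsP => n /=.
rewrite big_ord_recl /= mul1r subn0 big1 ?addr0 // => i _.
by rewrite mul0r.
Qed.

Fact fps_mulDl : left_distributive fps_mul fps_add.
Proof.
move=> f g h; apply: fpsP => n /=.
by rewrite -big_split; apply: eq_bigr => i _; rewrite mulrDl.
Qed.

Fact fps_one_neq0 : fps_one != fps_zero.
Proof.
apply/eqP => /(congr1 (fun f => coefs f 0)) /= /eqP.
by rewrite oner_eq0.
Qed.

HB.instance Definition _ := GRing.Zmodule_isComNzRing.Build (fps R)
  fps_mulA fps_mulC fps_mul1 fps_mulDl fps_one_neq0.

Lemma coefsD f g n : coefs (f + g) n = coefs f n + coefs g n.
Proof. by []. Qed.
Lemma coefsB f g n : coefs (f - g) n = coefs f n - coefs g n.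
Proof. by []. Qed.
Lemma coefs1 n : coefs (1 : fps R) n = (n == 0%N)%:R.
Proof. by []. Qed.
Lemma coefsM f g n :
  coefs (f * g) n = \sum_(k < n.+1) coefs f k * coefs g (n - k).
Proof. by []. Qed.

Lemma coefs_sum I (s : seq I) (P : pred I) (F : I -> fps R) n :
  coefs (\sum_(i <- s | P i) F i) n = \sum_(i <- s | P i) coefs (F i) n.
Proof. by apply: (big_morph (fun f => coefs f n)). Qed.

Definition fpsC (c : R) : fps R := FPS (fun n => if n == 0%N then c else 0).
Definition fpsX : fps R := FPS (fun n => (n == 1%N)%:R).

Lemma coefsCM c f n : coefs (fpsC c * f) n = c * coefs f n.
Proof.
rewrite coefsM big_ord_recl /= subn0 big1 ?addr0 // => i _.
by rewrite mul0r.
Qed.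

Lemma coefsX_small h n k : coefs h 0 = 0 -> (k < n)%N -> coefs (h ^+ n) k = 0.
Proof.
move=> h0; elim: n k => // n IHn k; rewrite ltnS => lekn.
rewrite exprS coefsM big1 // => -[[|i] /= lti] _; first by rewrite h0 mul0r.
rewrite IHn ?mulr0 //; case: k lekn lti => // k ltkn _.
by rewrite subSS (leq_ltn_trans (leq_subr _ _)).
Qed.

Definition fps_unit : {pred fps R} := fun f => coefs f 0 != 0.

(* f = c (1 - h) with c the constant coefficient of f and h(0) = 0, hence
   f^-1 = c^-1 (1 + h + h^2 + ...), where h^k only matters from u^k on. *)
Definition fps_inv f : fps R :=
  if f \in fps_unit then
    let c := fpsC (coefs f 0)^-1 in
    FPS (fun n => coefs (c * \sum_(k < n.+1) (1 - c * f) ^+ k) n)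
  else f.

Fact fps_mulV : {in fps_unit, left_inverse 1 fps_inv *%R}.
Proof.
move=> f Uf; have f0 : coefs f 0 != 0 := Uf.
rewrite /fps_inv Uf; set c := fpsC _; set h := 1 - c * f.
have h0 : coefs h 0 = 0.
  by rewrite coefsB coefs1 coefsCM mulVf // subrr.
apply: fpsP => n.
transitivity (coefs ((c * \sum_(k < n.+1) h ^+ k) * f) n).
  rewrite !coefsM; apply: eq_bigr => i _; congr (_ * _).
  rewrite -[LHS]/(coefs (c * \sum_(k < i.+1) h ^+ k) i) !coefsCM !coefs_sum.
  rewrite -!(big_mkord xpredT (fun k => coefs (h ^+ k) i)).
  rewrite [in RHS](@big_cat_nat _ _ _ i.+1) //= [X in _ + X]big_nat_cond.
  by rewrite [X in _ + X]big1 ?addr0 // => j /andP[/andP[/coefsX_small->]].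
rewrite mulrAC (_ : c * f = 1 - h); last by rewrite /h opprB addrC subrK.
by rewrite -[1 - h]opprB mulNr -subrX1 opprB coefsB coefsX_small // subr0.
Qed.

Fact fps_unitPl f g : g * f = 1 -> fps_unit f.
Proof.
move=> /(congr1 (fun f => coefs f 0)); rewrite coefsM big_ord1 coefs1 /=.
move=> gf1; apply/eqP => f0; move/eqP: gf1.
by rewrite f0 mulr0 eq_sym oner_eq0.
Qed.

Fact fps_inv_out : {in [predC fps_unit], fps_inv =1 id}.
Proof. by move=> f /negPf nUf; rewrite /fps_inv nUf. Qed.

HB.instance Definition _ := GRing.ComNzRing_hasMulInverse.Build (fps R)
  fps_mulV fps_unitPl fps_inv_out.

(* sum_{j >= 1} c_j u^{kj}, for k > 0 (so only j <= n contributes to u^n) *)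
Definition fps_sum1 (k : nat) (c : nat -> R) : fps R :=
  FPS (fun n => \sum_(1 <= j < n.+1 | (k * j)%N == n) c j).

(* P = prod_{d >= 1} F d for the u-adic topology: every coefficient of the
   partial products is eventually that of P. *)
Definition fps_has_prod1 (F : nat -> fps R) (P : fps R) : Prop :=
  forall n, exists D0, forall D, (D0 <= D)%N ->
    coefs (\prod_(1 <= d < D.+1) F d) n = coefs P n.

(* S = prod_{i = 0}^a prod_{d >= 1} F i d *)
Definition fps_eq_prod (a : nat) (F : nat -> nat -> fps R) (S : fps R) : Prop :=
  exists P : nat -> fps R,
    (forall i, (i <= a)%N -> fps_has_prod1 (F i) (P i)) /\
    S = \prod_(0 <= i < a.+1) P i.

End FPSRing.

Section PowersInGL.
Variable F : finFieldType.

Definition in_Phi (f : {poly F}) : Prop :=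
  [/\ f \is monic, irreducible_poly f & f != 'X].

(* The F[x]-module F^n on which x acts as A is isomorphic to a direct sum of
   modules F[x]/(f_i) with f_i in Phi. *)
Definition semisimple_mx n (A : 'M[F]_n.+1) : Prop :=
  exists (k : nat) (f : 'I_k -> {poly F})
         (phi : 'cV[F]_n.+1 -> {dffun forall i : 'I_k, {poly %/ f i}}),
    [/\ forall i, in_Phi (f i),
        bijective phi,
        forall u v i, phi (u + v) i = phi u i + phi v i
      & forall p v i,
          phi (horner_mx A p *m v) i = in_qpoly (f i) p * phi v i].

(* For n = 0 the library's 'GL_n[F] is GL(1, F); only n >= 1 is used below. *)
Definition GLss n : {set {'GL_n[F]}} :=
  [set x | `[< semisimple_mx (GLval x) >]].

Definition GLpow n M : {set {'GL_n[F]}} := [set (x ^+ M)%g | x in 'GL_n[F]%g].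

Definition GLpow_ss n M : {set {'GL_n[F]}} := GLss n :&: GLpow n M.

Definition c_ss n M : nat :=
  #|[set C in classes 'GL_n[F]%g | (C \subset GLss n) && (C \subset GLpow n M)]|.

(* N_M^i(q, d) for M = r ^ a and q = #|F|; a polynomial of degree d has
   size d.+1. *)
Definition Npow (r a i d : nat) : nat :=
  #|[set f : {poly_d.+1 F} |
      `[< [/\ in_Phi f, size f = d.+1 &
           let fM := (f : {poly F}) \Po 'X^(r ^ a) in
           if i == 0%N then
             exists g : {poly F},
               [/\ irreducible_poly g, g %| fM & size g = d.+1]
           else
             forall g : {poly F},
               irreducible_poly g -> g %| fM -> size g = (d * r ^ i).+1] >]]|.

End PowersInGL.

(* Main.v *)
Require Import Defs.
From HB Require Import structures.
From mathcomp Require Import all_boot all_order all_fingroup all_algebra.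
From mathcomp Require Import pgroup all_field mxabelem boolp.
From mathcomp Require Import zify.
Set Implicit Arguments.
Unset Strict Implicit.
Unset Printing Implicit Defensive.
Import GRing.Theory.
Local Open Scope ring_scope.

(** A matrix makes [F ^ n] a module over [F[x]].  It is semisimple when this module
   is the direct sum of the kernels of [f (A)] for [f] in [Phi]; these are vector
   spaces over the fields [F[x] / (f)], and their dimensions [m f] over these
   fields, with [\sum_f deg f * m f = n], determine the class of [A]
   ([semisimple_mxP], [ss_conjugate]).

   All of this is proved by counting frames, that is lists of vectors [w_k] which
   generate copies of [F[x] / (f_k)] in direct sum, for a given list of [f_k].  They
   are built greedily, a new vector being any element of the kernel of [f_k (A)]
   outside the span of the previous ones, so their number is a product of
   differences [q ^ nullity - q ^ (deg f * t)] ([size_frames_cons]).  Hence frames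
   exist as long as they fit; two frames that span, over the same list, are related
   by an isomorphism ([frames_conjugate]); and the frames that span are as many as
   the elements of the centralizer of [A] ([card_centralizer]), whose order is
   therefore the product over [f] of the orders of [GL(m f, q ^ deg f)].

   For powers, let [M = r ^ a] and [f] in [Phi].  The kernel of [f (B ^ M)] is the
   kernel at [B] of the polynomial [f (X ^ M)], which is squarefree.
   If all its irreducible factors have degree [deg f * r ^ i], the multiplicity of
   [f] in [B ^ M] is divisible by [r ^ i] ([power_nullity]); conversely, one factor
   of degree [deg f * r ^ i] suffices to obtain every multiple of [r ^ i], from a
   block diagonal matrix of companion matrices ([power_realization]).  Exactly one
   [i <= a] belongs to each [f]: if [e] is the order of the roots of [f], either [r]
   does not divide [e] and some [M]-th root has order [e], or all [M]-th roots have
   order [M * e] ([power_type_exists]); and this order determines the degree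
   ([root_order_exists]).

   So the semisimple classes of [M]-th powers correspond to the functions [m] with
   [r ^ i] dividing [m f] for each [f].  Expanding the product over [f] of the
   series [\sum_j c (deg f) (r ^ i * j) * u ^ (r ^ i * j * deg f)] gives the sum over
   these [m] of the products of the [c (deg f) (m f)] ([coefs_prod_family]).  With
   [c = 1] this counts classes; with [c d m] the inverse of the order of
   [GL(m, q ^ d)] each class is counted with its proportion in [GL(n, q)]. *)

Local Notation deg p := (size p).-1.

(** * Irreducible polynomials and the order of their roots *)

Section PolyFactors.
Variable F : finFieldType.
Implicit Types f g p : {poly F}.

Lemma irreducible_polyX : irreducible_poly ('X : {poly F}).
Proof. by rewrite -['X]subr0 -polyC0; apply: irredp_XsubC. Qed.

Lemma irreducible_deg_gt0 f : irreducible_poly f -> (0 < deg f)%N.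
Proof. by case=> f1 _; rewrite -subn1 subn_gt0. Qed.

Lemma irreducible_monic_scale g (g' := (lead_coef g)^-1 *: g) :
  irreducible_poly g -> [/\ g' \is monic, irreducible_poly g' & g' %= g].
Proof.
move=> irrg; have g0 := irredp_neq0 irrg.
have lc0 : (lead_coef g)^-1 != 0 by rewrite invr_eq0 lead_coef_eq0.
have eqg : g' %= g by rewrite eqp_scale.
split=> //; first by rewrite monicE lead_coefZ mulVf ?lead_coef_eq0.
split=> [|q q1]; first by rewrite size_scale // irrg.1.
rewrite dvdpZr // => /(apply_irredp irrg q1) eq_qg.
by apply: eqp_trans eq_qg _; rewrite eqp_sym.
Qed.


Lemma exists_monic_irreducible_factor p : (1 < size p)%N ->
  exists g, [/\ g \is monic, irreducible_poly g & g %| p].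
Proof.
have [n] := ubnP (size p); elim: n p => // n IHn p; rewrite ltnS => le_p_n p1.
have p0 : p != 0 by rewrite -size_poly_gt0 ltnW.
case: (irreducibleP p) => [irr_p | red_p].
  have [mp' irrp' eqp] := irreducible_monic_scale irr_p.
  by exists ((lead_coef p)^-1 *: p); rewrite (eqp_dvdl _ eqp).
have [q [q1 q_p ltqp]] : exists q : {poly F},
    [/\ (1 < size q)%N, q %| p & (size q < size p)%N].
  apply: contrapT => no_q; apply: red_p; split=> // q q1 q_p.
  rewrite -dvdp_size_eqp // eqn_leq dvdp_leq //= leqNgt; apply/negP => ltqp.
  apply: no_q; exists q; split=> //.
  by rewrite ltn_neqAle eq_sym q1 size_poly_gt0 (dvdpN0 q_p).
have [g [mg ig g_q]] := IHn q (leq_trans ltqp le_p_n) q1.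
by exists g; split=> //; apply: dvdp_trans g_q q_p.
Qed.

(** Computations in the finite field [L = F[x] / (g)], with [red 'X] as a root of
   [g]. *)
Section QuotientField.
Variables (g : {poly F}) (mi : monic_irreducible_poly g).
Let L := {poly %/ g with mi}.
Let red (p : {poly F}) : L := in_qpoly g p.

Let redB p1 p2 : red (p1 - p2) = red p1 - red p2.
Proof. exact: (raddfB (in_qpoly g)). Qed.
Let redX p n : red (p ^+ n) = red p ^+ n.
Proof. exact: (rmorphXn (in_qpoly g)). Qed.

Lemma qpoly_eq0 p : (red p == 0) = (g %| p).
Proof.
rewrite /red -val_eqE /= mk_monicE // /dvdp.
by rewrite -Pdiv.IdomainMonic.modpE // mi.2.
Qed.

Lemma qpoly_repr (y : L) : exists p, y = red p.
Proof.
by exists (polyn y); apply/val_inj/esym/in_qpoly_small/size_mk_monic.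
Qed.

(** The root generates [L] over [F], so that a power of Frobenius that fixes the
   root fixes [L]. *)
Lemma qpoly_card_gen k :
  red 'X ^+ (#|F| ^ k) = red 'X -> forall y : L, y ^+ (#|F| ^ k) = y.
Proof.
move=> fixX y; have [p ->] := qpoly_repr y.
have [c c_pr charc] := finPcharP F.
have charL : c \in [pchar L].
  have := rmorph_nat (in_qpoly g) c; rewrite -polyC_natr (pcharf0 charc).
  by rewrite polyC0 rmorph0 inE c_pr => /esym/eqP.
have charL_nat : [pchar L].-nat (#|F| ^ k)%N.
  rewrite pnatX; apply/orP; left.
  have := pprimeChar_pgroup charc; rewrite /pgroup cardsT.
  by apply: sub_in_pnat => i _ /eqP ->.
elim/poly_ind: p => [|p a IHp].
  rewrite /red in_qpoly0 expr0n expn_eq0.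
  by rewrite (gtn_eqF (ltnW (finNzRing_gt1 F))).
have -> : red (p * 'X + a%:P) = red p * red 'X + red a%:P.
  by rewrite /red in_qpolyD in_qpolyM.
rewrite exprDn_pchar // exprMn IHp fixX -redX -rmorphXn /=.
congr (_ + red _%:P); elim: (k) => // m IHm.
by rewrite expnSr exprM IHm expf_card.
Qed.

Lemma qpoly_expf_card k (y : L) : y ^+ (#|F| ^ (deg g * k)) = y.
Proof.
elim: k => [|k IHk]; first by rewrite muln0 expr1.
rewrite mulnS expnD exprM -[RHS]IHk; congr (_ ^+ _).
by rewrite -(card_qfpoly mi) expf_card.
Qed.

(** If Frobenius to the power [k] fixes [L], so does its power [t = k mod deg g];
   but [y ^ (q ^ t) - y] has at most [q ^ t] roots. *)
Lemma qpoly_frobenius_order k :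
  (red 'X ^+ (#|F| ^ k) == red 'X) = (deg g %| k)%N.
Proof.
have d_gt0 := irreducible_deg_gt0 mi.1.
apply/eqP/idP=> [/qpoly_card_gen fixL | /dvdnP[m ->]]; last first.
  by rewrite mulnC qpoly_expf_card.
rewrite /dvdn; set t := (k %% _)%N; apply: contraT; rewrite -lt0n => t_gt0.
have fixt (y : L) : y ^+ (#|F| ^ t) = y.
  rewrite -[RHS]fixL (divn_eq k (deg g)) expnD exprM.
  by rewrite [(_ * deg g)%N]mulnC qpoly_expf_card.
have q_gt1 := finNzRing_gt1 F.
have qt_gt1 : (1 < #|F| ^ t)%N by rewrite -(expn0 #|F|) ltn_exp2l.
pose P : {poly L} := 'X^(#|F| ^ t) - 'X.
have szP : size P = (#|F| ^ t).+1.
  by rewrite size_polyDl size_polyXn // size_polyN size_polyX.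
have P0 : P != 0 by rewrite -size_poly_gt0 szP.
have rootsP : all (root P) (enum L).
  by apply/allP => y _; rewrite /root !hornerE fixt subrr.
have := max_poly_roots P0 rootsP (enum_uniq L).
rewrite -cardE (card_qfpoly mi) szP ltnS leq_exp2l //.
by rewrite leqNgt ltn_mod d_gt0.
Qed.

Lemma qpoly_order_exists : g != 'X ->
  exists e, [/\ (0 < e)%N, (e %| (#|F| ^ deg g).-1)%N &
    forall N, (red 'X ^+ N == 1) = (e %| N)%N].
Proof.
move=> gX.
have x0 : red 'X != 0.
  rewrite qpoly_eq0; apply: contra gX => g_X.
  have: g %= 'X by apply: (apply_irredp irreducible_polyX); rewrite // gtn_eqF ?mi.1.1.
  by rewrite eqp_monic ?mi.2 ?monicX.
have q1 : (0 < (#|F| ^ deg g).-1)%N.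
  rewrite -subn1 subn_gt0 -{1}(expn0 #|F|) ltn_exp2l ?finNzRing_gt1 //.
  exact: irreducible_deg_gt0 mi.1.
have [|e prim_e e_q] := @prim_order_exists L _ (red 'X) q1.
  apply: (mulfI x0); rewrite -exprS mulr1 prednK; last first.
    by rewrite expn_gt0 ltnW ?finNzRing_gt1.
  by rewrite -{1}[deg g]muln1 qpoly_expf_card.
exists e; split=> // [|N]; first exact: prim_order_gt0 prim_e.
by rewrite (prim_order_dvd prim_e).
Qed.

Lemma qpoly_eq1_dvdp N : (red 'X ^+ N == 1) = (g %| 'X^N - 1).
Proof.
by rewrite -qpoly_eq0 redB redX (_ : red 1 = 1) ?subr_eq0 //; apply: in_qpoly1.
Qed.
End QuotientField.

(** The multiplicative order [e] of the roots of [g] determines the degree of [g],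
   which is the order of [#|F|] modulo [e]. *)
Lemma root_order_exists g : in_Phi g ->
  exists e, [/\ (0 < e)%N, (e %| (#|F| ^ deg g).-1)%N,
    forall N, (g %| 'X^N - 1) = (e %| N)%N &
    forall k, (deg g %| k)%N = (e %| (#|F| ^ k).-1)%N].
Proof.
case=> mg ig gX; pose mi : monic_irreducible_poly g := (ig, mg).
have [e [e_gt0 e_q eP]] := qpoly_order_exists mi gX.
exists e; split=> // [N | k]; first by rewrite -(qpoly_eq1_dvdp mi).
rewrite -(qpoly_frobenius_order mi).
have qk_gt0 : (0 < #|F| ^ k)%N by rewrite expn_gt0 ltnW ?finNzRing_gt1.
pose x : {poly %/ g with mi} := in_qpoly g 'X.
have eqx N : (x ^+ N == 1) = (e %| N)%N := eP N.
have x0 : x != 0.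
  apply: contraTneq e_gt0 => x0; have := eqx e.
  by rewrite dvdnn x0 expr0n; case: (e) => //= n; rewrite eq_sym oner_eq0.
rewrite -[in_qpoly g 'X]/x -eqx -{1}(prednK qk_gt0) exprS.
by apply/eqP/eqP => [xq | ->]; rewrite ?mulr1 //; apply: (mulfI x0); rewrite mulr1.
Qed.
End PolyFactors.

(** * Irreducible factors of [f (X ^ M)] *)

Section PowerSubstitution.
Variable F : finFieldType.
Implicit Types f g p : {poly F}.

(** Each step [y ^ r - 1 = (y - 1) (1 + y + ... + y ^ (r - 1))] gains a factor [r],
   since [y = 1] modulo [r]. *)
Lemma dvdn_sub1_exp_prime (r e a x : nat) : (r %| e)%N -> (0 < x)%N ->
  (e %| x.-1)%N -> (r ^ a * e %| (x ^ r ^ a).-1)%N.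
Proof.
move=> r_e; elim: a x => [|a IHa] x x_gt0 e_x; first by rewrite !expn0 mul1n expn1.
rewrite expnSr expnM -mulnA [(r * e)%N]mulnC mulnA.
set y := (x ^ r ^ a)%N; have y_gt0 : (0 < y)%N by rewrite expn_gt0 x_gt0.
have e_y := IHa x x_gt0 e_x; rewrite -/y in e_y.
rewrite -subn1 -(exp1n r) subn_exp subn1 dvdn_mul //.
have r_y1 : (y = 1 %[mod r])%N.
  apply/eqP; rewrite eqn_mod_dvd // subn1.
  by apply: dvdn_trans e_y; apply: dvdn_mull.
rewrite /dvdn; apply/eqP.
transitivity ((\sum_(i < r) 1) %% r)%N; last first.
  by rewrite sum1_card card_ord modnn.
rewrite -modn_summ -[RHS]modn_summ; congr (_ %% _)%N; apply: eq_bigr => i _.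
by rewrite exp1n muln1 -modnXm r_y1 modnXm exp1n.
Qed.

(** The last hypothesis says that an element of order [e'] has an [r ^ a]-th power of
   order [e].  Taking this power divides the order by [r ^ a], unless it removes the
   whole [r]-part, and then [r] would not divide [e]. *)
Lemma order_of_prime_power_root (r a e e' : nat) : prime r -> (r %| e)%N ->
  (0 < e)%N -> (0 < e')%N -> (forall N, (e %| N)%N = (e' %| N * r ^ a)%N) ->
  e' = (r ^ a * e)%N.
Proof.
move=> r_pr r_e e_gt0 e'_gt0 eP.
have e'_dvd : (e' %| r ^ a * e)%N by rewrite mulnC -eP.
have ra_e' : (r ^ a %| e')%N.
  set b := logn r e'; have [le_ab | lt_ba] := leqP a b.
    by apply: dvdn_trans (pfactor_dvdnn r e'); rewrite dvdn_exp2l.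
  have [m co_rm def_e'] := pfactor_coprime r_pr e'_gt0.
  have: (e %| m)%N by rewrite eP def_e' dvdn_mul // dvdn_exp2l // ltnW.
  by move/(dvdn_trans r_e) => r_m; move: co_rm; rewrite prime_coprime // r_m.
case/dvdnP: ra_e' => m def_e'; rewrite def_e' mulnC; congr (_ * _)%N.
have ra_gt0 : (0 < r ^ a)%N by rewrite expn_gt0 prime_gt0.
apply/eqP; rewrite eqn_dvd eP def_e' dvdnn andbT.
by rewrite -(dvdn_pmul2r ra_gt0) -def_e' [(e * _)%N]mulnC.
Qed.

Lemma Phi_coprimeX f : in_Phi f -> coprimep f 'X.
Proof.
case=> mf irrf fX; rewrite irreducible_poly_coprime //; apply: contra fX => f_X.
rewrite -eqp_monic ?monicX //; apply: apply_irredp f_X; first exact: irreducible_polyX.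
by rewrite gtn_eqF ?irrf.1.
Qed.

Lemma irreducible_coprimeX_Phi g : irreducible_poly g -> ~~ ('X %| g) ->
  exists g', in_Phi g' /\ g' %= g.
Proof.
move=> irrg Xg; have [mg' irrg' eqg] := irreducible_monic_scale irrg.
exists ((lead_coef g)^-1 *: g); split=> //; split=> //.
by apply: contraNneq Xg => def_g'; rewrite -(eqp_dvdr _ eqg) def_g'.
Qed.

Lemma dvdp_comp_sub p u v : u - v %| (p \Po u) - (p \Po v).
Proof.
elim/poly_ind: p => [|p c IHp]; first by rewrite !comp_poly0 subrr dvdp0.
rewrite !comp_poly_MXaddC opprD [X in _ %| X]addrACA subrr addr0.
rewrite -[X in _ %| X](subrKA ((p \Po v) * u)) -mulrBl -mulrBr.
by apply: dvdp_add; [apply: dvdp_mulr | apply: dvdp_mull].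
Qed.

Lemma dvdp_Xn_sub f e x y : (forall N, (f %| 'X^N - 1) = (e %| N)%N) ->
  (x = y %[mod e])%N -> f %| 'X^x - 'X^y.
Proof.
move=> eP; wlog le_yx : x y / (y <= x)%N => [IH | /eqP].
  case: (leqP y x) => [/IH // | /ltnW le_xy eq_xy].
  by rewrite -dvdpNr opprB IH.
rewrite eqn_mod_dvd // -eP => f_dvd.
rewrite -(subnK le_yx) exprD -[X in _ - X]mul1r -mulrBl.
exact: dvdp_mulr.
Qed.

Variable M : nat.
Hypothesis M_gt0 : (0 < M)%N.

Lemma dvdX_compXn p : ('X %| p \Po 'X^M) = ('X %| p).
Proof.
have dvdX q : ('X %| q) = root q 0.
  by rewrite -dvdp_XsubCl polyC0 subr0.
by rewrite !dvdX /root horner_comp hornerXn expr0n gtn_eqF.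
Qed.

(** If [f] does not divide [p], a relation [u f + v p = 1] survives the
   substitution of [X ^ M] for [X]. *)
Lemma dvdp_compXn f g p : irreducible_poly f -> (1 < size g)%N ->
  g %| f \Po 'X^M -> (g %| p \Po 'X^M) = (f %| p).
Proof.
move=> irrf g1 g_fM; apply/idP/idP => [g_pM | f_p]; last first.
  exact: dvdp_trans g_fM (dvdp_comp_poly _ f_p).
apply: contraT; rewrite -irreducible_poly_coprime // => /coprimep_comp_poly.
move=> /(_ 'X^M)/coprimepP/(_ g g_fM g_pM).
by rewrite -size_poly_eq1 gtn_eqF.
Qed.

Lemma Phi_factor_compXn f g : in_Phi f -> irreducible_poly g ->
  g %| f \Po 'X^M -> exists g', in_Phi g' /\ g' %= g.
Proof.
move=> Pf irrg g_fM; have [||g' [Pg' eqg]] := @irreducible_coprimeX_Phi g => //.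
  apply/negP => X_g; have := Phi_coprimeX Pf.
  rewrite coprimep_sym irreducible_poly_coprime; last exact: irreducible_polyX.
  by rewrite -dvdX_compXn (dvdp_trans X_g g_fM).
by exists g'.
Qed.

Lemma exists_factor_compXn f : in_Phi f ->
  exists g, in_Phi g /\ g %| f \Po 'X^M.
Proof.
move=> Pf; have [mf irrf _] := Pf.
have [|g [mg irrg g_fM]] := @exists_monic_irreducible_factor F (f \Po 'X^M).
  have f1 := irrf.1; have f0 := irredp_neq0 irrf.
  have lcf : lead_coef f != 0 by rewrite lead_coef_eq0.
  rewrite ltnNge; apply/negP => le1.
  have := coef_comp_poly_Xn f (M * (size f).-1) M_gt0.
  rewrite dvdn_mulr // mulKn // -lead_coefE nth_default => [/esym/eqP|].
    by rewrite (negPf lcf).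
  by apply: leq_trans le1 _; rewrite muln_gt0 M_gt0 irreducible_deg_gt0.
have [g' [Pg' eqg]] := Phi_factor_compXn Pf irrg g_fM.
by exists g'; split; rewrite // (eqp_dvdl _ eqg).
Qed.

(** [f] divides [X ^ N - 1] with [N = q ^ deg f - 1], and [X ^ (M * N) - 1] is
   separable since [M * N] is prime to [q]. *)
Lemma separable_compXn f : coprime #|F| M -> in_Phi f ->
  separable_poly (f \Po 'X^M).
Proof.
move=> co_qM Pf; have [e [e_gt0 e_q eP _]] := root_order_exists Pf.
set N := (#|F| ^ deg f).-1; have f_XN : f %| 'X^N - 1 by rewrite eP.
have /(dvdp_comp_poly 'X^M) := f_XN.
rewrite comp_polyB rmorph1 /= comp_Xn_poly -exprM => /dvdp_separable; apply.
apply: separable_Xn_sub_1.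
have [c c_pr charc] := finPcharP F.
have c_q : (c %| #|F|)%N.
  have := finNzRing_gt1 F; rewrite (card_pprimeChar charc).
  by case: (logn _ _) => // n _; rewrite expnS dvdn_mulr.
rewrite -(dvdn_pcharf charc) mulnC Euclid_dvdM //; apply/norP; split.
  apply/negP => c_N; have: (c %| N.+1)%N.
    rewrite prednK ?expn_gt0 ?(ltnW (finNzRing_gt1 F)) //.
    rewrite -(prednK (_ : 0 < deg f)%N) ?expnS ?dvdn_mulr //.
    by case: Pf => _ /irreducible_deg_gt0.
  by rewrite -addn1 (dvdn_addr _ c_N) dvdn1 gtn_eqF ?prime_gt1.
apply/negP => c_M; have: (c %| gcdn #|F| M)%N by rewrite dvdn_gcd c_q.
by rewrite (eqP co_qM) dvdn1 gtn_eqF ?prime_gt1.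
Qed.

End PowerSubstitution.

Section PowerType.
Variable F : finFieldType.
Implicit Types f g p : {poly F}.
Variables (r a : nat).
Hypothesis r_pr : prime r.

(** The condition under which [f] is counted by [Npow F r a i (deg f)]. *)
Definition power_type (i : nat) f : Prop :=
  if i == 0%N then
    exists g : {poly F},
      [/\ irreducible_poly g, g %| f \Po 'X^(r ^ a) & size g = size f]
  else
    forall g : {poly F}, irreducible_poly g -> g %| f \Po 'X^(r ^ a) ->
      size g = (deg f * r ^ i).+1.

Let ra_gt0 : (0 < r ^ a)%N. Proof. by rewrite expn_gt0 prime_gt0. Qed.

Lemma power_type_factor i f : in_Phi f -> power_type i f ->
  exists g, [/\ in_Phi g, g %| f \Po 'X^(r ^ a) & deg g = (deg f * r ^ i)%N].
Proof.
move=> Pf; rewrite /power_type; case: eqP => [-> [g [irrg g_fM szg]] | _ allg].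
  have [g' [Pg' eqg]] := Phi_factor_compXn ra_gt0 Pf irrg g_fM.
  by exists g'; rewrite (eqp_dvdl _ eqg) (eqp_size eqg) szg muln1.
have [g [Pg g_fM]] := exists_factor_compXn ra_gt0 Pf.
by exists g; split; rewrite // (allg g) //; case: Pg.
Qed.

Lemma power_type_uniq i j f : in_Phi f -> power_type i f -> power_type j f ->
  i = j.
Proof.
move=> Pf; have d_gt0 : (0 < deg f)%N by case: Pf => _ /irreducible_deg_gt0.
wlog: i j / (i <= j)%N => [IH ti tj | le_ij ti].
  by have [/IH|/ltnW/IH/(_ tj ti)/esym] := leqP i j; [apply|].
have [g [[_ irrg _] g_fM szg]] := power_type_factor Pf ti.
rewrite /power_type; case: eqP => [j0 _ | _ /(_ g irrg g_fM) szg'].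
  by apply/eqP; move: le_ij; rewrite j0 leqn0.
apply: (expnI (prime_gt1 r_pr)); apply/eqP.
by rewrite -(eqn_pmul2l d_gt0) -szg szg'.
Qed.

(** Let [e] be the order of the roots of [f].  If [r] does not divide [e], some
   power of a root is an [r ^ a]-th root of it.  Otherwise every [r ^ a]-th root
   of a root of [f] has order [r ^ a * e], so all factors of [f (X ^ (r ^ a))]
   have the same degree, which divides [deg f * r ^ a]. *)
Lemma power_type_exists f : in_Phi f ->
  exists i, (i <= a)%N /\ power_type i f.
Proof.
move=> Pf; have [mf irrf fX] := Pf; have f0 := irredp_neq0 irrf.
have [e [e_gt0 e_q eP degP]] := root_order_exists Pf.
have orderP g e' : in_Phi g -> g %| f \Po 'X^(r ^ a) ->
    (forall N, (g %| 'X^N - 1) = (e' %| N)%N) ->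
    forall N, (e %| N)%N = (e' %| N * r ^ a)%N.
  move=> [mg irrg gX] g_fM e'P N; rewrite -eP -e'P.
  rewrite -(dvdp_compXn _ irrf irrg.1 g_fM).
  by rewrite comp_polyB rmorph1 /= comp_Xn_poly -exprM mulnC.
have [r_e | r'e] := boolP (r %| e)%N; last first.
  exists 0%N; split=> //; rewrite /power_type /=.
  have co_er : coprime (r ^ a) e by rewrite coprimeXl // prime_coprime.
  have [m m_ra] : exists m, (m * r ^ a = 1 %[mod e])%N.
    have [u v def_u _] := egcdnP e ra_gt0; exists u.
    by rewrite def_u (eqP co_er) modnMDl.
  (* [X ^ m], with [m] inverse to [r ^ a] modulo [e], maps a root of [f] to a
     common root of [f (X ^ (r ^ a))] and [X ^ e - 1]. *)
  have [g [mg irrg g_fM g_Xe]] : exists g, [/\ g \is monic, irreducible_poly g,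
      g %| f \Po 'X^(r ^ a) & g %| 'X^e - 1].
    have Xe0 : 'X^e - 1 != 0 :> {poly F} by rewrite -size_poly_gt0 size_XnsubC.
    apply: contrapT => no_g.
    have co' : coprimep (f \Po 'X^(r ^ a)) ('X^e - 1).
      apply: contraT => /negbTE nco; exfalso; apply: no_g.
      set h := gcdp (f \Po 'X^(r ^ a)) ('X^e - 1).
      have [|g [mg irrg]] := @exists_monic_irreducible_factor F h.
        move: nco; rewrite /coprimep -/h; case: size (size_poly_gt0 h) => [|[|]] //.
        by rewrite gcdp_eq0 (negPf Xe0) andbF.
      by rewrite dvdp_gcd => /andP[]; exists g.
    have /coprimepP/(_ f) := coprimep_comp_poly 'X^m co'.
    rewrite -comp_polyA comp_polyB rmorph1 /= !comp_Xn_poly -!exprM eP dvdn_mull //.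
    have f_fXmM : f %| f \Po 'X^(m * r ^ a).
      rewrite -(dvdp_subl _ (dvdpp f)) -{3}[f]comp_polyXr.
      apply: dvdp_trans (dvdp_comp_sub _ _ _); rewrite -['X in X in _ %| X]expr1.
      exact: dvdp_Xn_sub eP m_ra.
    by move=> /(_ f_fXmM isT); rewrite -size_poly_eq1 gtn_eqF ?irrf.1.
  have [gX | gX] := eqVneq g 'X.
    have [g' [Pg' eqg']] := Phi_factor_compXn ra_gt0 Pf irrg g_fM.
    have [mg' irrg' g'X] := Pg'; move: eqg'; rewrite eqp_monic // => /eqP def_g'.
    by move: g'X; rewrite def_g' gX eqxx.
  have Pg : in_Phi g by [].
  have [e' [e'_gt0 _ e'P degP']] := root_order_exists Pg.
  have e_dvd := orderP g e' Pg g_fM e'P.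
  have def_e' : e' = e.
    by apply/eqP; rewrite eqn_dvd -e'P g_Xe e_dvd dvdn_mulr.
  exists g; split=> //.
  have f1 := irrf.1; have g1 := irrg.1.
  rewrite -(ltn_predK f1) -(ltn_predK g1); congr S; apply/eqP.
  by rewrite eqn_dvd degP' degP def_e' -degP -def_e' -degP' !dvdnn.
have deg_g g : in_Phi g -> g %| f \Po 'X^(r ^ a) ->
    forall k, (deg g %| k)%N = (r ^ a * e %| (#|F| ^ k).-1)%N.
  move=> Pg g_fM; have [e' [e'_gt0 _ e'P degP']] := root_order_exists Pg.
  have eP' := orderP g e' Pg g_fM e'P.
  by rewrite -(order_of_prime_power_root r_pr r_e e_gt0 e'_gt0 eP').
have [g0 [Pg0 g0_fM]] := exists_factor_compXn ra_gt0 Pf.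
have deg0P := deg_g g0 Pg0 g0_fM.
have q_gt0 k : (0 < #|F| ^ k)%N by rewrite expn_gt0 ltnW ?finNzRing_gt1.
have d_gt0 := irreducible_deg_gt0 irrf.
have /dvdnP[m def_g0] : (deg f %| deg g0)%N.
  rewrite degP; apply: (@dvdn_trans (r ^ a * e)%N); first exact: dvdn_mull.
  by rewrite -deg0P.
have : (deg g0 %| deg f * r ^ a)%N.
  by rewrite deg0P expnM dvdn_sub1_exp_prime // -degP.
rewrite def_g0 mulnC dvdn_pmul2l // => /(dvdn_pfactor _ _ r_pr)[i le_ia def_m].
exists i; split=> //; have allg g : irreducible_poly g ->
    g %| f \Po 'X^(r ^ a) -> size g = (deg f * r ^ i).+1.
  move=> irrg g_fM; rewrite -def_m mulnC -def_g0.
  have [g' [Pg' eqg]] := Phi_factor_compXn ra_gt0 Pf irrg g_fM.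
  rewrite -(eqp_size eqg); have g'1 : (1 < size g')%N by case: Pg' => _ [].
  rewrite -(ltn_predK g'1); congr S; apply/eqP.
  have g'_fM : g' %| f \Po 'X^(r ^ a) by rewrite (eqp_dvdl _ eqg).
  by rewrite eqn_dvd deg0P (deg_g g') // -deg0P -(deg_g g') // !dvdnn.
rewrite /power_type; case: eqP => // i0; exists g0; split=> //.
  by case: Pg0.
have [_ irrg0 _] := Pg0; rewrite (allg g0) // i0 muln1.
by rewrite (ltn_predK irrf.1).
Qed.

End PowerType.

(** * Frames of the module defined by a matrix *)

Lemma in_tail (T : eqType) (P : T -> Prop) (x : T) (s : seq T) :
  {in x :: s, forall y, P y} -> {in s, forall y, P y}.
Proof. by move=> Pxs y y_s; apply: Pxs; rewrite inE y_s orbT. Qed.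

Section Frames.
Variables (F : finFieldType) (n : nat).
Implicit Types (A : 'M[F]_n.+1) (f g p : {poly F}) (v w : 'rV[F]_n.+1).
Implicit Types (s : seq {poly F}) (L : seq 'rV[F]_n.+1).

(** When a polynomial of degree [d] kills [w], the rows span the submodule
   generated by [w]. *)
Definition krylov A d w : 'M[F]_(d, n.+1) := \matrix_(i < d) (w *m A ^+ i).

Lemma mulmx_krylov A d w (c : 'rV_d) :
  c *m krylov A d w = w *m horner_mx A (rVpoly c).
Proof.
rewrite mulmx_sum_row [rVpoly c]poly_def linear_sum mulmx_sumr.
apply: eq_bigr => i _; rewrite valK /= linearZ -scalemxAr rmorphXn /= horner_mx_X.
by rewrite rowK.
Qed.

Lemma mul_horner_mx A v p q :
  v *m horner_mx A (p * q) = v *m horner_mx A p *m horner_mx A q.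
Proof. by rewrite rmorphM -mulmxA. Qed.

Lemma horner_mx_dvdp0 A v p q : v *m horner_mx A p = 0 -> p %| q ->
  v *m horner_mx A q = 0.
Proof. by move=> vp0 /dvdpP[u ->]; rewrite mulrC mul_horner_mx vp0 mul0mx. Qed.

Lemma irreducible_annihilator A f v p : irreducible_poly f ->
  v *m horner_mx A f = 0 -> v != 0 -> v *m horner_mx A p = 0 -> f %| p.
Proof.
move=> irrf vf0 v0 vp0; apply: contraNT v0; rewrite -irreducible_poly_coprime //.
case/Bezout_eq1_coprimepP=> -[u1 u2] /= eq1.
rewrite -[v]mulmx1 -[1%:M]/(1 : 'M_n.+1) -(rmorph1 (horner_mx A)) -eq1.
by rewrite rmorphD mulmxDr !(mulrC u1, mulrC u2) !mul_horner_mx vf0 vp0 !mul0mx addr0.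
Qed.

Lemma sub_krylov A f w v : f != 0 -> w *m horner_mx A f = 0 ->
  (v <= krylov A (deg f) w)%MS <-> exists p, v = w *m horner_mx A p.
Proof.
move=> f0 wf0; split=> [/submxP[c ->] | [p ->]].
  by exists (rVpoly c); rewrite mulmx_krylov.
have szp : (size (p %% f)%R <= deg f)%N.
  by rewrite -ltnS prednK ?size_poly_gt0 ?ltn_modp.
rewrite {1}(divp_eq p f) rmorphD mulmxDr mulrC mul_horner_mx wf0 mul0mx add0r.
by rewrite -(poly_rV_K szp) -mulmx_krylov submxMl.
Qed.

Lemma rank_krylov A f w : irreducible_poly f -> w *m horner_mx A f = 0 ->
  w != 0 -> \rank (krylov A (deg f) w) = deg f.
Proof.
move=> irrf wf0 w0; apply/eqP/row_freeP/row_freeP.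
rewrite -kermx_eq0; apply/rowV0P => c /sub_kermxP.
rewrite mulmx_krylov => /(irreducible_annihilator irrf wf0 w0) f_c.
apply: (can_inj rVpolyK); rewrite linear0; apply/eqP; apply: contraTT f_c => c0.
rewrite gtNdvdp // (leq_ltn_trans (size_poly _ _)) // prednK //.
exact: ltnW irrf.1.
Qed.

Fixpoint framespan A s L : 'M[F]_n.+1 :=
  if (s, L) is (f :: s', w :: L') then
    (krylov A (deg f) w + framespan A s' L')%MS
  else 0.

(** A vector [w] killed by the irreducible [f] generates a simple module, which meets
   the span of the tail in [0] unless it lies in it: the conditions say that [L]
   generates the direct sum of the [F[x] / (f)] for [f] in [s]. *)
Fixpoint frame A s L : bool :=
  match s, L with
  | [::], [::] => true
  | f :: s', w :: L' =>
    [&& w *m horner_mx A f == 0, ~~ (w <= framespan A s' L')%MS & frame A s' L']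
  | _, _ => false
  end.

(** The map of [F[x]]-modules that sends the standard basis to [L]. *)
Definition comb A L (p : nat -> {poly F}) : 'rV[F]_n.+1 :=
  \sum_(i < size L) L`_i *m horner_mx A (p i).

Lemma comb_cons A w L (p : nat -> {poly F}) :
  comb A (w :: L) p = w *m horner_mx A (p 0%N) + comb A L (fun i => p i.+1).
Proof. by rewrite /comb big_ord_recl. Qed.

Lemma comb_scale A L (p : nat -> {poly F}) q :
  comb A L p *m horner_mx A q = comb A L (fun i => p i * q).
Proof.
by rewrite /comb mulmx_suml; apply: eq_bigr => i _; rewrite mul_horner_mx.
Qed.

Lemma frame_size A s L : frame A s L -> size L = size s.
Proof.
by elim: s L => [|f s IHs] [|w L] //= /and3P[_ _ /IHs ->].
Qed.

Lemma frame_nz A f s w L : frame A (f :: s) (w :: L) -> w != 0.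
Proof. by case/and3P=> _ + _; apply: contraNneq => ->; apply: sub0mx. Qed.

Section IrreducibleFrame.
Variables (A : 'M[F]_n.+1).

Lemma sub_framespan s L v : {in s, forall f, irreducible_poly f} -> frame A s L ->
  (v <= framespan A s L)%MS <-> exists ps, v = comb A L ps.
Proof.
elim: s L v => [|f s IHs] [|w L] v //= irr.
  rewrite submx0 => _; split=> [/eqP -> | [ps ->]]; last by rewrite /comb big_ord0.
  by exists (fun=> 0); rewrite /comb big_ord0.
have irrf : irreducible_poly f by apply: irr; rewrite mem_head.
have f0 := irredp_neq0 irrf.
have irrs := in_tail irr.
case/and3P=> /eqP wf0 _ /(IHs _ _ irrs) IHv; split=> [/sub_addsmxP[[c1 c2] /= ->]|].
  have /(sub_krylov _ f0 wf0)[p0 ->] := submxMl c1 (krylov A (deg f) w).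
  have /IHv[p ->] := submxMl c2 (framespan A s L).
  by exists (fun i => if i is j.+1 then p j else p0); rewrite comb_cons.
case=> p ->; rewrite comb_cons; apply: addmx_sub_adds.
  by apply/(sub_krylov _ f0 wf0); exists (p 0%N).
by apply/IHv; exists (fun i => p i.+1).
Qed.

Lemma framespan_stable s L v p : {in s, forall f, irreducible_poly f} ->
  frame A s L -> (v <= framespan A s L)%MS -> (v *m horner_mx A p <= framespan A s L)%MS.
Proof.
move=> irr fr /(sub_framespan _ irr fr)[q ->]; apply/(sub_framespan _ irr fr).
by exists (fun i => q i * p); rewrite comb_scale.
Qed.

(** The submodule generated by [w] is simple, so it meets the span of the tail in
   [0] as soon as [w] is not in this span. *)
Lemma frame_cap f s w L p : {in f :: s, forall f, irreducible_poly f} ->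
  frame A (f :: s) (w :: L) -> (w *m horner_mx A p <= framespan A s L)%MS -> f %| p.
Proof.
move=> irr /and3P[/eqP wf0 w_nspan fr] wp.
have irrf : irreducible_poly f by apply: irr; rewrite mem_head.
have irrs := in_tail irr.
apply: contraNT w_nspan; rewrite -irreducible_poly_coprime //.
case/Bezout_eq1_coprimepP=> -[u1 u2] /= eq1.
rewrite -[w]mulmx1 -[1%:M]/(1 : 'M_n.+1) -(rmorph1 (horner_mx A)) -eq1.
rewrite rmorphD mulmxDr !(mulrC u1, mulrC u2) !mul_horner_mx wf0 mul0mx add0r.
exact: framespan_stable.
Qed.

Lemma frame_capmx f s w L : {in f :: s, forall f, irreducible_poly f} ->
  frame A (f :: s) (w :: L) -> (krylov A (deg f) w :&: framespan A s L)%MS = 0.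
Proof.
move=> irr fr; apply/eqP/rowV0P => v; rewrite sub_capmx => /andP[].
have irrf : irreducible_poly f by apply: irr; rewrite mem_head.
have /and3P[/eqP wf0 _ _] := fr.
move/(sub_krylov _ (irredp_neq0 irrf) wf0) => [p ->] /(frame_cap irr fr).
exact: horner_mx_dvdp0.
Qed.

(** The kernel of [comb] depends on [s] alone, which makes frames over the same list
   comparable, even for different matrices. *)
Lemma comb_eq0 s L (p : nat -> {poly F}) :
  {in s, forall f, irreducible_poly f} -> frame A s L ->
  comb A L p = 0 <-> forall i, (i < size s)%N -> s`_i %| p i.
Proof.
elim: s L p => [|f s IHs] [|w L] p // irr fr.
  by split=> // _; rewrite /comb big_ord0.
have irrs := in_tail irr.
have /and3P[/eqP wf0 _ fr'] := fr; rewrite comb_cons.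
split=> [comb0 | f_p].
  have f_p0 : f %| p 0%N.
    apply: (frame_cap irr fr); apply/(sub_framespan _ irrs fr').
    exists (fun i => p i.+1 * -1); rewrite -comb_scale rmorphN1 mulmxN mulmx1.
    by apply/eqP; rewrite -addr_eq0 comb0.
  move: comb0; rewrite (horner_mx_dvdp0 wf0 f_p0) add0r => /IHs h [|i] //=.
  exact: h.
rewrite (horner_mx_dvdp0 wf0 (f_p 0%N isT)) add0r.
by apply/(IHs _ _ irrs fr') => i; apply: (f_p i.+1).
Qed.

Lemma rank_framespan s L : {in s, forall f, irreducible_poly f} -> frame A s L ->
  \rank (framespan A s L) = sumn [seq deg f | f <- s].
Proof.
elim: s L => [|f s IHs] [|w L] // irr fr; first by rewrite mxrank0.
have irrs := in_tail irr.
have irrf : irreducible_poly f by apply: irr; rewrite mem_head.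
have /and3P[/eqP wf0 _ fr'] := fr.
rewrite /= mxrank_disjoint_sum ?frame_capmx // rank_krylov ?IHs //.
exact: frame_nz fr.
Qed.

End IrreducibleFrame.
End Frames.

(** * Counting frames *)

Section FrameCount.
Variables (F : finFieldType) (n : nat).
Implicit Types (A : 'M[F]_n.+1) (f g p : {poly F}) (v w : 'rV[F]_n.+1).
Implicit Types (s : seq {poly F}) (L : seq 'rV[F]_n.+1) (ps : nat -> {poly F}).

Definition nullity A p := \rank (kermxpoly A p).

Definition monic_irr f : Prop := f \is monic /\ irreducible_poly f.

Lemma monic_irr_coprime f g : monic_irr f -> monic_irr g -> f != g ->
  coprimep f g.
Proof.
move=> [mf irrf] [mg irrg]; rewrite irreducible_poly_coprime //.
apply: contra => f_g; rewrite -eqp_monic //; apply: (apply_irredp irrg) f_g.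
by rewrite gtn_eqF ?irrf.1.
Qed.

Lemma sub_kermxpoly A p v :
  reflect (v *m horner_mx A p = 0) (v <= kermxpoly A p)%MS.
Proof. exact: sub_kermxP. Qed.

(** Only the generators killed by [g] contribute to the kernel of [g (A)]. *)
Lemma rank_ker_span A s L g : {in s, forall f, monic_irr f} -> monic_irr g ->
  frame A s L ->
  \rank (kermxpoly A g :&: framespan A s L) = (deg g * count_mem g s)%N.
Proof.
move=> + ming; elim: s L => [|f s IHs] [|w L] // mi fr.
  by rewrite capmx0 mxrank0 muln0.
have mis := in_tail mi.
have irr : {in f :: s, forall f, irreducible_poly f} by move=> h /mi[].
have irrs : {in s, forall f, irreducible_poly f} by move=> h /mis[].
have minf := mi f (mem_head _ _).
have /and3P[/eqP wf0 _ fr'] := fr.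
have irrf := minf.2; have f0 := irredp_neq0 irrf.
have capK := frame_capmx irr fr; rewrite /= -/(framespan A s L).
case: eqP => [fg | /eqP fg]; rewrite -?fg ?add1n ?mulnS ?add0n.
  have K_ker : (krylov A (deg f) w <= kermxpoly A f)%MS.
    apply/row_subP => i; apply/sub_kermxpoly.
    have /(sub_krylov _ f0 wf0)[p ->] := row_sub i (krylov A (deg f) w).
    by rewrite -mul_horner_mx mulrC mul_horner_mx wf0 mul0mx.
  rewrite capmxC -(matrix_modl _ K_ker) mxrank_disjoint_sum; last first.
    apply/eqP; rewrite -submx0 -capK capmxS ?submx_refl // capmxSl //.
  rewrite capmxC fg IHs // -fg rank_krylov //; exact: frame_nz fr.
rewrite -(IHs L mis fr'); apply/eqmx_rank/andP; split; last first.
  by rewrite capmxS ?submx_refl ?addsmxSr.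
apply/row_subP => i; set v := row i _.
have: (v <= kermxpoly A g :&: (krylov A (deg f) w + framespan A s L))%MS.
  exact: row_sub.
rewrite !sub_capmx => /andP[/[dup] v_ker ->] /=.
case/sub_addsmxP=> -[c1 c2] /= def_v.
have /(sub_krylov _ f0 wf0)[p def_x] := submxMl c1 (krylov A (deg f) w).
have y_span := submxMl c2 (framespan A s L).
have /(frame_cap irr fr) : (w *m horner_mx A (p * g) <= framespan A s L)%MS.
  rewrite mul_horner_mx -def_x -[_ *m krylov _ _ _](addrK (c2 *m framespan A s L)).
  rewrite -def_v mulmxBl (sub_kermxpoly _ _ _ v_ker) sub0r eqmx_opp.
  exact: framespan_stable.
rewrite Gauss_dvdpl ?monic_irr_coprime // => f_p.
by rewrite def_v def_x (horner_mx_dvdp0 wf0 f_p) add0r.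
Qed.

Fixpoint frames A s : seq (seq 'rV[F]_n.+1) :=
  if s is f :: s' then
    [seq w :: L | L <- frames A s', w <- [seq w <- enum {: 'rV[F]_n.+1} |
       (w *m horner_mx A f == 0) && ~~ (w <= framespan A s' L)%MS]]
  else [:: [::]].

Lemma mem_frames A s L : (L \in frames A s) = frame A s L.
Proof.
elim: s L => [|f s IHs] [|w L] //=.
  by apply/allpairsPdep => -[? [? []]].
apply/allpairsPdep/and3P => [[L' [w' [fr]]] | [wf w_span fr]].
  rewrite mem_filter mem_enum andbT => /andP[wf0 w_span] [-> ->].
  by rewrite -IHs.
by exists L, w; rewrite IHs mem_filter mem_enum wf w_span.
Qed.

Lemma frames_uniq A s : uniq (frames A s).
Proof.
elim: s => //= f s IHs; apply: allpairs_uniq_dep => // [L _|].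
  by rewrite filter_uniq ?enum_uniq.
by move=> [L w] [L' w'] _ _ /= [-> ->].
Qed.

Lemma card_kermxpoly_diff A f s L : {in s, forall f, monic_irr f} ->
  monic_irr f -> frame A s L ->
  size [seq w <- enum {: 'rV[F]_n.+1} |
       (w *m horner_mx A f == 0) && ~~ (w <= framespan A s L)%MS] =
  (#|F| ^ nullity A f - #|F| ^ (deg f * count_mem f s))%N.
Proof.
move=> mi minf fr.
rewrite -(rank_ker_span mi minf fr) -!card_rowg.
have -> : rowg (kermxpoly A f :&: framespan A s L)%MS
    = rowg (kermxpoly A f) :&: rowg (framespan A s L).
  by apply/setP => v; rewrite !inE sub_capmx.
rewrite -cardsD cardE; congr size; rewrite /enum_mem -filter_predI.
apply: eq_filter => v /=; rewrite !inE andbT andbC; congr (_ && _).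
exact/eqP/sub_kermxpoly.
Qed.

Lemma size_frames_cons A f s : {in f :: s, forall f, monic_irr f} ->
  size (frames A (f :: s)) =
  ((#|F| ^ nullity A f - #|F| ^ (deg f * count_mem f s)) * size (frames A s))%N.
Proof.
move=> mi; have mis := in_tail mi.
have minf := mi f (mem_head _ _).
rewrite /= size_allpairs_dep sumnE big_map.
rewrite (eq_big_seq (fun=> (#|F| ^ nullity A f - #|F| ^ (deg f * count_mem f s))%N)).
  by rewrite big_const_seq count_predT iter_addn_0 mulnC.
by move=> L; rewrite mem_frames => fr; rewrite card_kermxpoly_diff.
Qed.

(** The hypothesis leaves room for all generators but one in each kernel, and a bit
   more; that this forces room for the last one too gives [deg_dvd_nullity]. *)
Lemma frames_gt0 A s : {in s, forall f, monic_irr f} ->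
  {in s, forall f, (deg f * (count_mem f s).-1 < nullity A f)%N} ->
  (0 < size (frames A s))%N.
Proof.
elim: s => [|f s IHs] // mi lt_null; rewrite size_frames_cons // muln_gt0.
have mis := in_tail mi.
apply/andP; split.
  have := lt_null f (mem_head _ _); rewrite /= eqxx /= subn_gt0.
  by rewrite ltn_exp2l ?finNzRing_gt1.
apply: IHs => // g g_s; have := lt_null g; rewrite inE g_s orbT => /(_ isT).
apply: leq_ltn_trans; rewrite leq_mul2l /=.
by apply/orP; right; rewrite -!subn1 leq_sub2r ?leq_addl.
Qed.

(** The kernel of [g (A)] is a vector space over [F[x] / (g)]: a frame in it that
   does not span it can be extended, and the rank of its span is a multiple of
   [deg g]. *)
Lemma deg_dvd_nullity A g : monic_irr g -> (deg g %| nullity A g)%N.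
Proof.
move=> ming; have d_gt0 := irreducible_deg_gt0 ming.2.
set m := (nullity A g %/ deg g)%N.
have [//| ndvd] := boolP (deg g %| nullity A g)%N.
have lt_m : (deg g * m < nullity A g)%N.
  by rewrite mulnC ltn_neqAle leq_trunc_div andbT -dvdn_eq.
have mi : {in nseq m.+1 g, forall f, monic_irr f}.
  by move=> f; rewrite mem_nseq => /andP[_ /eqP ->].
have : (0 < size (frames A (nseq m.+1 g)))%N.
  apply: frames_gt0 => // f; rewrite mem_nseq => /andP[_ /eqP ->].
  by rewrite count_nseq /= eqxx mul1n.
case def_fr: (frames A _) => [|L l] // _.
have fr : frame A (nseq m.+1 g) L by rewrite -mem_frames def_fr mem_head.
have := mxrankS (capmxSl (kermxpoly A g) (framespan A (nseq m.+1 g) L)).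
rewrite (rank_ker_span mi ming fr) count_nseq /= eqxx mul1n leqNgt.
by rewrite mulnC ltn_ceil.
Qed.

Lemma framespan_full A s L : {in s, forall f, irreducible_poly f} ->
  frame A s L -> sumn [seq deg f | f <- s] = n.+1 ->
  forall v, exists ps, v = comb A L ps.
Proof.
move=> irr fr deg_s v; apply/(sub_framespan _ irr fr)/submx_full.
by rewrite /row_full (rank_framespan irr fr) deg_s.
Qed.

Lemma comb_sum A L (I : finType) (c : I -> F) (q : I -> nat -> {poly F}) :
  comb A L (fun i => \sum_j c j *: q j i) = \sum_j c j *: comb A L (q j).
Proof.
rewrite /comb; under [RHS]eq_bigr do rewrite scaler_sumr.
rewrite exchange_big; apply: eq_bigr => i _.
rewrite linear_sum mulmx_sumr; apply: eq_bigr => j _.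
by rewrite linearZ -scalemxAr.
Qed.

Lemma comb_sub A L (p q : nat -> {poly F}) :
  comb A L (fun i => p i - q i) = comb A L p - comb A L q.
Proof.
by rewrite /comb -sumrB; apply: eq_bigr => i _; rewrite rmorphB mulmxBr.
Qed.

Lemma horner_mx_intertwine A A' P p : A *m P = P *m A' ->
  horner_mx A p *m P = P *m horner_mx A' p.
Proof.
move=> AP; elim/poly_ind: p => [|p c IHp]; first by rewrite !rmorph0 mul0mx mulmx0.
rewrite !rmorphD !rmorphM /= !horner_mx_X !horner_mx_C mulmxDl mulmxDr.
by rewrite -mulmxA AP !mulmxA IHp scalar_mxC.
Qed.

Lemma comb_intertwine A A' P L ps : A *m P = P *m A' ->
  comb A L ps *m P = comb A' (map (mulmx^~ P) L) ps.
Proof.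
move=> AP; rewrite /comb mulmx_suml size_map; apply: eq_bigr => i _.
by rewrite (nth_map 0) // -!mulmxA (horner_mx_intertwine _ AP).
Qed.

(** By [comb_eq0], sending one frame to the other extends to a well defined
   isomorphism of modules. *)
Lemma frames_conjugate A A' s L L' : {in s, forall f, irreducible_poly f} ->
  frame A s L -> frame A' s L' -> sumn [seq deg f | f <- s] = n.+1 ->
  exists P, [/\ P \in unitmx, A *m P = P *m A' & map (mulmx^~ P) L = L'].
Proof.
move=> irr fr fr' deg_s; have full := framespan_full irr fr deg_s.
have /boolp.choice[q qP] (j : 'I_n.+1) : exists ps, delta_mx 0 j = comb A L ps.
  exact: full.
(* [q j] are the coordinates of the [j]-th basis vector in [L]; [P] maps the vector
   with these coordinates in [L] to the one with the same coordinates in [L']. *)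
pose P := \matrix_j comb A' L' (q j).
have combP ps : comb A L ps *m P = comb A' L' ps.
  rewrite mulmx_sum_row; under eq_bigr do rewrite rowK.
  rewrite -comb_sum; apply/eqP; rewrite eq_sym -subr_eq0 -comb_sub; apply/eqP.
  apply/(comb_eq0 _ irr fr')/(comb_eq0 _ irr fr).
  rewrite comb_sub comb_sum; under eq_bigr do rewrite -qP.
  by rewrite -row_sum_delta subrr.
have fullA v : v *m A = v *m horner_mx A 'X by rewrite horner_mx_X.
have AP : A *m P = P *m A'.
  apply/row_matrixP => i; rewrite !rowE !mulmxA.
  have [ps ->] := full (delta_mx 0 i).
  by rewrite fullA comb_scale !combP -comb_scale horner_mx_X.
exists P; split=> //.
  rewrite -row_free_unit -kermx_eq0; apply/rowV0P => v /sub_kermxP.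
  have [ps ->] := full v; rewrite combP => /(comb_eq0 _ irr fr').
  by move/(comb_eq0 _ irr fr).
have szL := frame_size fr; have szL' := frame_size fr'.
apply: (@eq_from_nth _ 0); rewrite size_map szL ?szL' // => i lt_i.
have delta (B : 'M[F]_n.+1) K : (i < size K)%N ->
    comb B K (fun j => (j == i)%:R) = K`_i.
  move=> lt_iK; rewrite /comb (bigD1 (Ordinal lt_iK)) //= eqxx rmorph1 mulmx1.
  rewrite big1 ?addr0 // => j; rewrite -val_eqE /= => /negPf ->.
  by rewrite rmorph0 mulmx0.
by rewrite (nth_map 0) ?szL // -(delta A) ?szL // combP delta ?szL'.
Qed.

Lemma framespan_intertwine A A' P s L : A *m P = P *m A' ->
  (framespan A' s (map (mulmx^~ P) L) :=: framespan A s L *m P)%MS.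
Proof.
move=> AP; elim: s L => [|f s IHs] [|w L] //=; rewrite ?mul0mx //.
apply: eqmx_trans (eqmx_sym (addsmxMr _ _ _)); apply: adds_eqmx => //.
have -> : krylov A' (deg f) (w *m P) = krylov A (deg f) w *m P; last by [].
apply/row_matrixP => i; rewrite row_mul !rowK -!mulmxA; congr (_ *m _).
elim: (val i) => [|k IHk]; first by rewrite !expr0 mulmx1 mul1mx.
by rewrite !exprS -!mulmxE mulmxA -AP -mulmxA IHk mulmxA.
Qed.

Lemma frame_intertwine A A' P s L : P \in unitmx -> A *m P = P *m A' ->
  frame A' s (map (mulmx^~ P) L) = frame A s L.
Proof.
move=> Pu AP; elim: s L => [|f s IHs] [|w L] //=; rewrite IHs.
rewrite (framespan_intertwine _ _ AP) submxMfree ?row_free_unit //.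
have := comb_intertwine [:: w] (fun=> f) AP; rewrite /comb /= !big_ord1 /= => <-.
congr (_ && _); apply/eqP/eqP => [wP0 | ->]; last by rewrite mul0mx.
by rewrite -[LHS](mulmxK Pu) wP0 mul0mx.
Qed.

(** An automorphism of the module is determined by the image of one frame, which
   can be any other. *)
Lemma card_centralizer A s : {in s, forall f, irreducible_poly f} ->
  (0 < size (frames A s))%N -> sumn [seq deg f | f <- s] = n.+1 ->
  #|[set P : 'M[F]_n.+1 | (P \in unitmx) && (A *m P == P *m A)]|
    = size (frames A s).
Proof.
move=> irr + deg_s; case def_fr: {1}(frames A s) => [|L l] // _.
have fr : frame A s L by rewrite -mem_frames def_fr mem_head.
set C := [set P | _]; rewrite cardE -(size_map (fun P => map (mulmx^~ P) L)).
apply/perm_size/uniq_perm; last 1 first.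
- move=> L'; rewrite mem_frames; apply/mapP/idP => [[P] | fr'].
    by rewrite mem_enum inE => /andP[Pu /eqP AP] ->; rewrite (frame_intertwine _ _ Pu AP).
  have [P [Pu AP defL']] := frames_conjugate irr fr fr' deg_s.
  by exists P; rewrite // mem_enum inE Pu AP eqxx.
- rewrite map_inj_in_uniq ?enum_uniq // => P Q; rewrite !mem_enum !inE.
  case/andP=> Pu /eqP AP /andP[Qu /eqP AQ] eqPQ; apply/row_matrixP => i.
  have [ps def_i] := framespan_full irr fr deg_s (delta_mx 0 i).
  by rewrite !rowE def_i (comb_intertwine _ _ AP) (comb_intertwine _ _ AQ) eqPQ.
exact: frames_uniq.
Qed.

End FrameCount.

(** * Semisimple matrices and their primary components *)

Section Multilist.
Variables (I : finType) (T : eqType).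
Implicit Types (m : I -> nat) (g : I -> T).

Definition multilist m g : seq T := flatten [seq nseq (m i) (g i) | i <- enum I].

Lemma mem_multilist m g x :
  reflect (exists i, (0 < m i)%N /\ x = g i) (x \in multilist m g).
Proof.
apply: (iffP flatten_mapP) => [[i _] | [i [mi ->]]].
  by rewrite mem_nseq => /andP[mi /eqP ->]; exists i.
by exists i; rewrite ?mem_enum // mem_nseq mi eqxx.
Qed.

Lemma big_multilist m g (h : T -> nat) :
  (\sum_(x <- multilist m g) h x = \sum_i m i * h (g i))%N.
Proof.
rewrite big_flatten big_map big_enum /=; apply: eq_bigr => i _.
by rewrite big_nseq iter_addn_0 mulnC.
Qed.

Lemma count_multilist m g i : injective g -> count_mem (g i) (multilist m g) = m i.
Proof.
move=> inj_g; rewrite -sum1_count big_mkcond big_multilist (bigD1 i) //= eqxx muln1.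
by rewrite big1 ?addn0 // => j ji; rewrite (inj_eq inj_g) (negPf ji) muln0.
Qed.

End Multilist.

Section PhiType.
Variables (F : finFieldType) (N : nat).

(** The finite part of [Phi] that matters for matrices of size [N]. *)
Definition Phi_le : predArgType := {f : {poly_N.+1 F} | `[< in_Phi (f : {poly F}) >]}.
HB.instance Definition _ := Finite.on Phi_le.

Definition Phi_poly (f : Phi_le) : {poly F} := polyn (val f).

Lemma Phi_polyP f : in_Phi (Phi_poly f).
Proof. exact/asboolP/(valP f). Qed.

Lemma Phi_poly_inj : injective Phi_poly.
Proof. by move=> f g eq_fg; apply/val_inj/val_inj. Qed.

Lemma Phi_poly_surj (f : {poly F}) : in_Phi f -> (size f <= N.+1)%N ->
  exists f', Phi_poly f' = f.
Proof.
move=> Pf szf.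
have Pf' : `[< in_Phi (polyn (@NPoly F N.+1 f szf)) >] by apply/asboolP.
by exists (exist (fun f : {poly_N.+1 F} => is_true `[< in_Phi (polyn f) >]) _ Pf').
Qed.

Lemma size_Phi_poly f : (size (Phi_poly f) <= N.+1)%N.
Proof. exact: size_npoly. Qed.

End PhiType.
Coercion Phi_poly : Phi_le >-> polynomial.

Section Semisimple.
Variables (F : finFieldType) (n : nat).
Implicit Types (A B : 'M[F]_n.+1) (f g p : {poly F}) (S : seq {poly F}).

Lemma Phi_monic_irr f : in_Phi f -> monic_irr f. Proof. by case. Qed.

Lemma nullity_le A p : (nullity A p <= n.+1)%N.
Proof. exact: rank_leq_row. Qed.

Lemma nullityE A p : nullity A p = (n.+1 - \rank (horner_mx A p))%N.
Proof. exact: mxrank_ker. Qed.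

Lemma nullity_eq_dim A p : (nullity A p == n.+1) = (horner_mx A p == 0).
Proof.
rewrite nullityE -mxrank_eq0; have := rank_leq_row (horner_mx A p).
by case: (\rank _) => [|k] lek; rewrite ?subn0 ?eqxx // subSS ltn_eqF // ltnS leq_subr.
Qed.

Lemma nullityM A p q : coprimep p q ->
  nullity A (p * q) = (nullity A p + nullity A q)%N.
Proof.
move=> co_pq; rewrite /nullity kermxpolyM // mxrank_disjoint_sum //.
exact: mxdirect_kermxpoly.
Qed.

Lemma nullity_prod A S : uniq S -> {in S, forall f, monic_irr f} ->
  nullity A (\prod_(f <- S) f) = (\sum_(f <- S) nullity A f)%N.
Proof.
elim: S => [|f S IHS] /=; first by rewrite !big_nil /nullity kermxpoly1 mxrank0.
case/andP=> f_S uniqS mi; have miS := in_tail mi.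
rewrite !big_cons nullityM ?IHS //.
rewrite big_seq; elim/big_rec: _ => [|g p g_S co_fp]; first exact: coprimep1.
rewrite coprimepMr co_fp andbT; apply: monic_irr_coprime; first exact: mi (mem_head _ _).
  exact: miS.
by apply: contraNneq f_S => ->.
Qed.

Lemma deg_Phi_gt0 f : in_Phi f -> (0 < deg f)%N.
Proof. by case=> _ /irreducible_deg_gt0. Qed.

Lemma nullity_Phi_big A f : in_Phi f -> (n.+2 < size f)%N -> nullity A f = 0%N.
Proof.
move=> Pf szf; have := deg_dvd_nullity A (Phi_monic_irr Pf).
case: (posnP (nullity A f)) => // null_gt0 /(dvdn_leq null_gt0).
move/leq_trans/(_ (nullity_le A f)); rewrite -(leq_add2r 1) !addn1.
by rewrite prednK ?(leq_ltn_trans _ szf) // leqNgt szf.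
Qed.

(** The dimension of the largest submodule that is a sum of modules [F[x] / (f)]
   with [f] in [Phi]. *)
Definition ss_dim A := (\sum_(f : Phi_le F n.+1) nullity A f)%N.

Let PhiS := map (@Phi_poly F n.+1) (enum {: Phi_le F n.+1}).

Let PhiS_uniq : uniq PhiS.
Proof. by rewrite map_inj_uniq ?enum_uniq //; apply: Phi_poly_inj. Qed.

Let mem_PhiS f : f \in PhiS -> in_Phi f.
Proof. by case/mapP=> f' _ ->; apply: Phi_polyP. Qed.

Let ss_dimE A : ss_dim A = nullity A (\prod_(f <- PhiS) f).
Proof.
rewrite nullity_prod //; last by move=> f /mem_PhiS/Phi_monic_irr.
by rewrite big_map big_enum.
Qed.

Lemma ss_dim_le A : (ss_dim A <= n.+1)%N.
Proof. by rewrite ss_dimE nullity_le. Qed.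

Lemma ss_dim_annihilated A S : uniq S -> {in S, forall f, in_Phi f} ->
  horner_mx A (\prod_(f <- S) f) = 0 -> ss_dim A = n.+1.
Proof.
move=> uniqS PS /eqP; rewrite -nullity_eq_dim nullity_prod //; last first.
  by move=> f /PS/Phi_monic_irr.
move/eqP => dimS; apply/eqP; rewrite eqn_leq ss_dim_le -[X in (X <= _)%N]dimS.
rewrite /ss_dim (bigID (fun f : {poly F} => (size f <= n.+2)%N)) /=.
rewrite [X in (_ + X)%N]big_seq_cond [X in (_ + X)%N]big1 ?addn0; last first.
  by move=> f /andP[/PS Pf]; rewrite -ltnNge; apply: nullity_Phi_big.
have -> : (\sum_(f : Phi_le F n.+1) nullity A f = \sum_(f <- PhiS) nullity A f)%N.
  by rewrite big_map big_enum.
rewrite -big_filter; apply: uniq_sub_le_big => // [x y||].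
- exact: leq_addr.
- exact: filter_uniq.
move=> f; rewrite mem_filter => /andP[szf /PS Pf].
by have [f' <-] := Phi_poly_surj Pf szf; rewrite map_f ?mem_enum.
Qed.

Definition mult A f := (nullity A f %/ deg f)%N.

Lemma mult_nullity A f : monic_irr f -> (deg f * mult A f)%N = nullity A f.
Proof. by move=> mi; rewrite mulnC divnK ?deg_dvd_nullity. Qed.

(** If [A] is semisimple, its module is the sum of the [F[x] / (f)], [f] in this
   list. *)
Definition primary_list A := multilist (mult A \o @Phi_poly F n.+1) (@Phi_poly F n.+1).

Lemma primary_list_monic_irr A : {in primary_list A, forall f, monic_irr f}.
Proof. by move=> f /mem_multilist[f' [_ ->]]; apply/Phi_monic_irr/Phi_polyP. Qed.

Lemma primary_list_irr A : {in primary_list A, forall f, irreducible_poly f}.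
Proof. by move=> f /primary_list_monic_irr[]. Qed.

Lemma primary_list_deg A : ss_dim A = n.+1 ->
  sumn [seq deg f | f <- primary_list A] = n.+1.
Proof.
move=> ssA; rewrite sumnE big_map big_multilist -[RHS]ssA; apply: eq_bigr => f _.
by rewrite mulnC mult_nullity //; apply/Phi_monic_irr/Phi_polyP.
Qed.

Lemma primary_list_nullity A : {in primary_list A, forall f,
  (deg f * count_mem f (primary_list A))%N = nullity A f}.
Proof.
move=> f /mem_multilist[f' [_ ->]]; rewrite count_multilist; last exact: Phi_poly_inj.
by rewrite /= mult_nullity //; apply/Phi_monic_irr/Phi_polyP.
Qed.

Lemma primary_list_frames A A' :
  (forall f : Phi_le F n.+1, nullity A' f = nullity A f) ->
  (0 < size (frames A' (primary_list A)))%N.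
Proof.
move=> eqA; apply: frames_gt0; first exact: primary_list_monic_irr.
move=> f f_A; have /mem_multilist[f' [_ def_f]] := f_A.
rewrite def_f eqA -def_f -(primary_list_nullity f_A) ltn_mul2l.
rewrite {1}def_f deg_Phi_gt0 /=; last exact: Phi_polyP.
by rewrite prednK // -has_count has_pred1.
Qed.

Lemma nullity_intertwine A A' P p : P \in unitmx -> A *m P = P *m A' ->
  nullity A p = nullity A' p.
Proof.
move=> Pu AP; rewrite !nullityE; congr (_ - _)%N.
rewrite -(mxrankMfree (horner_mx A p) (_ : row_free P)) ?row_free_unit //.
rewrite (horner_mx_intertwine _ AP).
by rewrite eqmxMfull ?row_full_unit.
Qed.

(** Semisimple matrices with the same nullities have frames over the same list. *)
Lemma ss_conjugate A A' : ss_dim A = n.+1 ->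
  (forall f : Phi_le F n.+1, nullity A' f = nullity A f) ->
  exists P, P \in unitmx /\ A *m P = P *m A'.
Proof.
move=> ssA eqA.
have := primary_list_frames (fun _ => erefl : nullity A _ = _).
have := primary_list_frames eqA.
case fr': (frames A' _) => [|L' l'] // _; case fr: (frames A _) => [|L l] // _.
have frL : frame A (primary_list A) L by rewrite -mem_frames fr mem_head.
have frL' : frame A' (primary_list A) L' by rewrite -mem_frames fr' mem_head.
have deg_s := primary_list_deg ssA.
have [P [Pu AP _]] := frames_conjugate (@primary_list_irr A) frL frL' deg_s.
by exists P.
Qed.

Lemma trmx_horner_mx A p : (horner_mx A p)^T = horner_mx A^T p.
Proof.
elim/poly_ind: p => [|p c IHp]; first by rewrite !rmorph0 trmx0.
rewrite !rmorphD !rmorphM /= !horner_mx_X !horner_mx_C linearD /= tr_scalar_mx.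
rewrite -!mulmxE trmx_mul IHp; congr (_ + _).
exact/comm_mx_horner/comm_mx_refl.
Qed.

Lemma nullity_trmx A p : nullity A^T p = nullity A p.
Proof. by rewrite !nullityE -trmx_horner_mx mxrank_tr. Qed.

Lemma in_qpoly_eq0 f p : monic_irr f -> (in_qpoly f p == 0) = (f %| p).
Proof. by case=> mf irrf; apply: (qpoly_eq0 (irrf, mf)). Qed.

Lemma semisimple_mx_dim A : semisimple_mx A -> ss_dim A = n.+1.
Proof.
case=> k [f [phi [Pf bij_phi phiD phiM]]].
have inj_phi := bij_inj bij_phi.
pose S := undup [seq f i | i <- enum 'I_k].
have PS : {in S, forall g, in_Phi g}.
  by move=> g; rewrite mem_undup => /mapP[i _ ->].
apply: (@ss_dim_annihilated A S) => //; first exact: undup_uniq.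
set p := \prod_(g <- S) g.
have ann (v : 'cV_n.+1) : horner_mx A p *m v = 0.
  have phi0 i : phi 0 i = 0.
    by apply: (addrI (phi 0 i)); rewrite -phiD !addr0.
  apply: inj_phi; apply/ffunP => i; rewrite phiM phi0.
  have: f i %| p.
    rewrite /p (big_rem (f i)) ?dvdp_mulr //.
    by rewrite mem_undup map_f ?mem_enum.
  by rewrite -(in_qpoly_eq0 _ (Phi_monic_irr (Pf i))) => /eqP ->; rewrite mul0r.
apply/trmx_inj/row_matrixP => i; rewrite trmx0 row0 rowE.
by apply: trmx_inj; rewrite trmx_mul trmxK ann trmx0.
Qed.

(** The converse: a frame for the transpose of [A], whose row vectors are the
   column vectors on which [A] acts, gives the coordinates [phi]. *)
Lemma dim_semisimple_mx A : ss_dim A = n.+1 -> semisimple_mx A.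
Proof.
move=> ssA; set s := primary_list A; have irr := @primary_list_irr A.
have mi := @primary_list_monic_irr A.
have [L fr] : exists L, frame A^T s L.
  have := primary_list_frames (fun f : Phi_le F n.+1 => nullity_trmx A f).
  case def_fr: (frames _ _) => [|L l] // _; exists L.
  by rewrite -mem_frames def_fr mem_head.
have full := framespan_full irr fr (primary_list_deg ssA).
have /boolp.choice[ps psP] (v : 'cV[F]_n.+1) : exists ps, v^T = comb A^T L ps.
  exact: full.
pose f (i : 'I_(size s)) := s`_i.
have f_s i : f i \in s by apply: mem_nth.
pose phi v : {dffun forall i : 'I_(size s), {poly %/ f i}} :=
  [ffun i : 'I_(size s) => in_qpoly (f i) (ps v i)].
have phiE v qs i : v^T = comb A^T L qs -> phi v i = in_qpoly (f i) (qs i).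
  move=> def_v; rewrite ffunE; apply/eqP; rewrite -subr_eq0 -linearB /=.
  rewrite in_qpoly_eq0; last exact: mi.
  have /(comb_eq0 _ irr fr) : comb A^T L (fun j => ps v j - qs j) = 0.
    by rewrite comb_sub -psP -def_v subrr.
  exact.
exists (size s), f, phi; split=> [i||u v i|p v i].
- by have /mem_multilist[g [_ ->]] := f_s i; apply: Phi_polyP.
- pose psi (u : {dffun forall i : 'I_(size s), {poly %/ f i}}) : 'cV[F]_n.+1 :=
    (comb A^T L (fun j => if insub j is Some i then polyn (u i) else 0))^T.
  have psiK : cancel psi phi.
    move=> u; apply/ffunP => i; rewrite (phiE _ _ _ (trmxK _)) valK /=.
    exact/val_inj/in_qpoly_small/size_mk_monic.
  exists psi => //; apply: (inj_can_sym psiK) => u v eq_phi.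
  apply: trmx_inj; apply/eqP; rewrite psP [v^T]psP -subr_eq0 -comb_sub; apply/eqP.
  apply/(comb_eq0 _ irr fr) => i lt_i; move/ffunP/(_ (Ordinal lt_i)): eq_phi.
  rewrite !ffunE => /eqP; rewrite -subr_eq0 -linearB /= in_qpoly_eq0 //.
  exact: mi.
- rewrite (phiE _ (fun j => ps u j + ps v j)); last first.
    rewrite linearD /= !psP.
    by rewrite /comb -big_split; apply: eq_bigr => j _; rewrite rmorphD mulmxDr.
  by rewrite linearD !ffunE.
rewrite (phiE _ (fun j => ps v j * p)); last first.
  by rewrite trmx_mul trmx_horner_mx psP comb_scale.
by rewrite mulrC in_qpolyM !ffunE.
Qed.

Lemma semisimple_mxP A : semisimple_mx A <-> ss_dim A = n.+1.
Proof. by split; [apply: semisimple_mx_dim | apply: dim_semisimple_mx]. Qed.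

End Semisimple.

(** * Powers of semisimple matrices *)

Section Realization.
Variable F : finFieldType.
Implicit Types (f g p : {poly F}) (t : seq {poly F}).

Lemma nullity_annihilated n (C : 'M[F]_n.+1) g p : irreducible_poly g ->
  horner_mx C g = 0 -> nullity C p = (if (g %| p)%R then n.+1 else 0)%N.
Proof.
move=> irrg Cg0; case: ifP => [/dvdpP[u ->] | /negbT].
  by apply/eqP; rewrite nullity_eq_dim rmorphM /= Cg0 mulr0.
rewrite -irreducible_poly_coprime // => /(nullityM C).
have /eqP -> : nullity C g == n.+1 by rewrite nullity_eq_dim Cg0.
by have := nullity_le C (g * p); lia.
Qed.

Lemma horner_mx_block m n (C : 'M[F]_m.+1) (B : 'M[F]_n.+1) p :
  horner_mx (block_mx C 0 0 B : 'M_((m + n.+1).+1)) p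
    = block_mx (horner_mx C p) 0 0 (horner_mx B p) :> 'M_(m.+1 + n.+1).
Proof.
have mulD (C1 C2 : 'M[F]_m.+1) (B1 B2 : 'M[F]_n.+1) :
    (block_mx C1 0 0 B1 : 'M_((m + n.+1).+1)) * block_mx C2 0 0 B2
      = block_mx (C1 *m C2) 0 0 (B1 *m B2).
  by have := mulmx_block C1 0 0 B1 C2 0 0 B2; rewrite !mulmx0 !mul0mx !addr0 !add0r.
have addD (C1 C2 : 'M[F]_m.+1) (B1 B2 : 'M[F]_n.+1) :
    (block_mx C1 0 0 B1 : 'M_((m + n.+1).+1)) + block_mx C2 0 0 B2
      = block_mx (C1 + C2) 0 0 (B1 + B2).
  by have := add_block_mx C1 0 0 B1 C2 0 0 B2; rewrite !addr0.
have scalD c :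
    c%:M = block_mx (c%:M : 'M_m.+1) 0 0 (c%:M : 'M_n.+1) :> 'M[F]_((m + n.+1).+1).
  exact: (scalar_mx_block m.+1 n.+1 c).
elim/poly_ind: p => [|p c IHp].
  by have := block_mx_const m.+1 n.+1 m.+1 n.+1 (0 : F); rewrite !rmorph0 => ->.
by rewrite !rmorphD !rmorphM /= !horner_mx_X !horner_mx_C IHp mulD scalD addD.
Qed.

Lemma nullity_block m n (C : 'M[F]_m.+1) (B : 'M[F]_n.+1) p :
  nullity (block_mx C 0 0 B : 'M_((m + n.+1).+1)) p = (nullity C p + nullity B p)%N.
Proof.
have rk : \rank (horner_mx (block_mx C 0 0 B : 'M_((m + n.+1).+1)) p)
    = (\rank (horner_mx C p) + \rank (horner_mx B p))%N.
  by rewrite horner_mx_block -[RHS]rank_diag_block_mx.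
rewrite !nullityE rk.
have := rank_leq_row (horner_mx C p); have := rank_leq_row (horner_mx B p).
lia.
Qed.

Lemma exists_companion m g : g \is monic -> size g = m.+2 ->
  exists C : 'M[F]_m.+1, horner_mx C g = 0.
Proof.
move=> mg szg; have := companionmxK mg; move: (companionmx g).
rewrite szg /= => C charC; exists C.
by rewrite -charC Cayley_Hamilton.
Qed.

(** The block diagonal matrix of the companion matrices of [t]. *)
Lemma exists_mx_of_list n t : {in t, forall g, monic_irr g} ->
  sumn [seq deg g | g <- t] = n.+1 ->
  exists B : 'M[F]_n.+1, forall p,
    nullity B p = (\sum_(g <- t) (g %| p)%R * deg g)%N.
Proof.
elim: t n => // g t IHt n mi; have [mg irrg] := mi g (mem_head _ _).
have mit := in_tail mi.
have [m szg] : exists m, size g = m.+2.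
  by case: (size g) irrg.1 => [|[|m]] // _; exists m.
have [C Cg0] := exists_companion mg szg; rewrite /= szg /=.
have nulC p : nullity C p = ((g %| p)%R * m.+1)%N.
  by rewrite (nullity_annihilated _ irrg Cg0); case: ifP; rewrite ?mul1n ?mul0n.
case def_k: (sumn _) => [|k].
  rewrite addn0 => -[<-]; exists C => p; rewrite big_cons szg nulC /=.
  case: t def_k {IHt mi} mit => [|h t] /=; first by rewrite big_nil addn0.
  move=> + mit; have [_ [h1 _]] := mit h (mem_head _ _).
  by case: (size h) h1 => [|[]].
move=> -[<-]; have [B nulB] := IHt k mit def_k.
exists (block_mx C 0 0 B : 'M_((m + k.+1).+1)) => p.
by rewrite nullity_block nulC nulB big_cons szg.
Qed.

Variable n : nat.
Implicit Types A B : 'M[F]_n.+1.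

Lemma horner_mx_exp B M p : horner_mx (B ^+ M) p = horner_mx B (p \Po 'X^M).
Proof.
elim/poly_ind: p => [|p c IHp]; first by rewrite comp_poly0 !rmorph0.
rewrite comp_poly_MXaddC !rmorphD !rmorphM /= IHp horner_mx_X !horner_mx_C.
by rewrite rmorphXn /= horner_mx_X.
Qed.

Lemma nullity_exp B M p : nullity (B ^+ M) p = nullity B (p \Po 'X^M).
Proof. by rewrite !nullityE horner_mx_exp. Qed.

(** By the primary decomposition, from [deg_dvd_nullity] for each irreducible
   factor of [p]. *)
Lemma dvdn_nullity_separable e B p : separable_poly p ->
  (forall g, irreducible_poly g -> g %| p -> (e %| deg g)%N) ->
  (e %| nullity B p)%N.
Proof.
have [k] := ubnP (size p); elim: k p => // k IHk p; rewrite ltnS => le_pk sep_p e_p.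
have p0 := separable_poly_neq0 sep_p.
have [le1 | p1] := leqP (size p) 1.
  have [c c0 ->] : exists2 c, c != 0 & p = c%:P.
    by move: p0; rewrite (size1_polyC le1) polyC_eq0 => c0; exists p`_0.
  by rewrite /nullity kermxpolyC // mxrank0 dvdn0.
have [g [mg irrg /dvdpP[p' def_p]]] := exists_monic_irreducible_factor p1.
have co : coprimep p' g by apply: (separable_coprime sep_p); rewrite def_p.
rewrite def_p nullityM // dvdn_add //; last first.
  apply: dvdn_trans (deg_dvd_nullity B (conj mg irrg)).
  by apply: e_p; rewrite // def_p dvdp_mull.
apply: IHk.
- apply: leq_trans le_pk; rewrite def_p size_Mmonic //; last first.
    by apply: contraNneq p0 => p'0; rewrite def_p p'0 mul0r.
  rewrite -(ltn_predK irrg.1) addnS -[X in (X < _)%N]addn0 ltn_add2l.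
  by rewrite -subn1 subn_gt0 irrg.1.
- by apply: dvdp_separable sep_p; rewrite def_p dvdp_mulr.
by move=> h irrh h_p'; apply: e_p; rewrite // def_p dvdp_mulr.
Qed.

Variables (r a : nat).
Hypotheses (r_pr : prime r) (co_q : coprime #|F| (r ^ a)).

(** The [f]-component of [B ^ (r ^ a)] is the sum of the [g]-components of [B] for
   the factors [g] of [f (X ^ (r ^ a))], of degree [deg f * r ^ i] if [0 < i]. *)
Lemma power_nullity B f i : in_Phi f -> power_type r a i f ->
  (r ^ i %| mult (B ^+ (r ^ a)) f)%N.
Proof.
move=> Pf; have d_gt0 := deg_Phi_gt0 Pf.
rewrite -(dvdn_pmul2l d_gt0) (mult_nullity _ (Phi_monic_irr Pf)).
rewrite /power_type; case: eqP => [-> _ | _ allg].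
  by rewrite muln1 (deg_dvd_nullity _ (Phi_monic_irr Pf)).
rewrite nullity_exp; apply: dvdn_nullity_separable => [|g irrg g_fM].
  by apply: separable_compXn.
by rewrite (allg g).
Qed.

Lemma unitmx_nullityX B : (B \in unitmx) = (nullity B 'X == 0%N).
Proof.
by rewrite /nullity kermxpolyX mxrank_eq0 kermx_eq0 row_free_unit.
Qed.

(** For each [f] take [m f %/ r ^ i] copies of one factor of degree [deg f * r ^ i]
   of [f (X ^ (r ^ a))]. *)
Lemma power_realization (idx : Phi_le F n.+1 -> nat) (m : Phi_le F n.+1 -> nat) :
  (forall f : Phi_le F n.+1, power_type r a (idx f) f) ->
  (forall f : Phi_le F n.+1, (r ^ idx f %| m f)%N) ->
  (\sum_(f : Phi_le F n.+1) deg f * m f = n.+1)%N ->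
  exists B, B \in unitmx /\
    forall f : Phi_le F n.+1, nullity (B ^+ (r ^ a)) f = (deg f * m f)%N.
Proof.
move=> idxP idx_m sum_m.
have Phi (f : Phi_le F n.+1) := Phi_polyP f.
have ra_gt0 : (0 < r ^ a)%N by rewrite expn_gt0 prime_gt0.
have /boolp.choice[g gP] (f : Phi_le F n.+1) : exists g : {poly F},
    [/\ in_Phi g, g %| f \Po 'X^(r ^ a) & deg g = (deg f * r ^ idx f)%N].
  exact: power_type_factor.
pose t := multilist (fun f : Phi_le F n.+1 => m f %/ r ^ idx f)%N g.
have Pt h : h \in t -> in_Phi h by case/mem_multilist=> f [_ ->]; case: (gP f).
have mf (f : Phi_le F n.+1) : (m f %/ r ^ idx f * deg (g f) = deg f * m f)%N.
  by have [_ _ ->] := gP f; rewrite mulnCA mulnC divnK // mulnC.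
have mit : {in t, forall h, monic_irr h} by move=> h /Pt/Phi_monic_irr.
have deg_t : sumn [seq deg (h : {poly F}) | h <- t] = n.+1.
  rewrite sumnE big_map big_multilist -[RHS]sum_m.
  by apply: eq_bigr => f _; apply: mf.
have [B nulB] := exists_mx_of_list mit deg_t; exists B; split.
  rewrite unitmx_nullityX nulB big_seq big1 // => h /Pt Ph.
  have [_ irrh _] := Ph; have := Phi_coprimeX Ph.
  by rewrite irreducible_poly_coprime // => /negPf ->; rewrite mul0n.
move=> f; rewrite nullity_exp nulB big_multilist (bigD1 f) //= big1 ?addn0.
  have [_ -> _] := gP f; by rewrite mul1n mf.
move=> f' f'f; have [[_ irrg _] g_fM _] := gP f'.
have [_ irrf' _] := Phi f'; rewrite (dvdp_compXn _ irrf' irrg.1 g_fM).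
rewrite -[_ %| _]negbK -irreducible_poly_coprime // monic_irr_coprime ?muln0 //.
- exact: Phi_monic_irr.
exact: Phi_monic_irr.
Qed.

End Realization.

(** * Classes of semisimple powers *)

Section Classes.
Variables (F : finFieldType) (n r a : nat).
Hypotheses (r_pr : prime r) (co_q : coprime #|F| (r ^ a)).
Variable idx : Phi_le F n.+1 -> nat.
Hypothesis idxP : forall f : Phi_le F n.+1, power_type r a (idx f) f.
Notation G := 'GL_n.+1[F]%g.
Notation X := (GLpow_ss F n.+1 (r ^ a)).
Implicit Types (A : 'M[F]_n.+1) (f : Phi_le F n.+1) (x y : {'GL_n.+1[F]}).

(** The factors in [size_frames_cons], collected according to their polynomial. *)
Lemma size_frames_prod A (s : seq {poly F}) :
  {in s, forall g, exists f : Phi_le F n.+1, g = Phi_poly f} ->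
  size (frames A s) = (\prod_(f : Phi_le F n.+1) \prod_(t < count_mem (f : {poly F}) s)
    (#|F| ^ nullity A f - #|F| ^ (deg f * t)))%N.
Proof.
elim: s => [|g s IHs] sP; first by rewrite big1 // => f _; rewrite big_ord0.
have sP' := in_tail sP.
rewrite size_frames_cons; last first.
  by move=> h /sP[f ->]; apply/Phi_monic_irr/Phi_polyP.
have [f def_g] := sP g (mem_head _ _); rewrite IHs // def_g.
rewrite [in RHS](bigD1 f) // [in LHS](bigD1 f) //= eqxx add1n big_ord_recr /=.
rewrite mulnA [(_ * \prod_(t < _) _)%N]mulnC; congr (_ * _)%N.
apply: eq_bigr => h hf; suff /negPf -> : (f : {poly F}) != h by rewrite add0n.
by rewrite (inj_eq (@Phi_poly_inj _ _)) eq_sym.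
Qed.

Lemma GLval_exp x k : GLval (x ^+ k)%g = GLval x ^+ k.
Proof. by elim: k => // k IHk; rewrite expgS GL_ME IHk exprS. Qed.

Lemma GL_lift P : P \in unitmx -> exists x : {'GL_n.+1[F]}, GLval x = P.
Proof. by move=> Pu; exists (FinRing.Unit (Pu : P \is a GRing.unit)). Qed.

Lemma GLval_inj : injective (@GLval n.+1 F).
Proof. exact: val_inj. Qed.

Lemma mem_GLss x : x \in GLss F n.+1 <-> ss_dim (GLval x) = n.+1.
Proof.
rewrite inE; split=> [/asboolP/semisimple_mxP // | ssx].
exact/asboolP/semisimple_mxP.
Qed.

Lemma mem_GLpow x k : x \in GLpow F n.+1 k <-> exists y, x = (y ^+ k)%g.
Proof.
split=> [/imsetP[y _ ->] | [y ->]]; first by exists y.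
by apply/imsetP; exists y; rewrite ?inE.
Qed.

Definition mult_type x : {ffun Phi_le F n.+1 -> 'I_n.+2} :=
  [ffun f : Phi_le F n.+1 => inord (mult (GLval x) f)].

(** The multiplicities that semisimple [r ^ a]-th powers have, where [idx f] is the
   [i] for which [f] is counted by [Npow]. *)
Definition power_types : {set {ffun Phi_le F n.+1 -> 'I_n.+2}} :=
  [set m : {ffun Phi_le F n.+1 -> 'I_n.+2} |
           (\sum_(f : Phi_le F n.+1) deg f * m f == n.+1)%N &&
           [forall f : Phi_le F n.+1, r ^ idx f %| m f]%N].

Lemma mult_typeE x f : mult_type x f = mult (GLval x) f :> nat.
Proof.
by rewrite ffunE inordK // ltnS (leq_trans (leq_div _ _)) ?nullity_le.
Qed.

Lemma mult_type_nullity x f : nullity (GLval x) f = (deg f * mult_type x f)%N.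
Proof. by rewrite mult_typeE mult_nullity //; apply/Phi_monic_irr/Phi_polyP. Qed.

Lemma mult_type_in x : x \in X -> mult_type x \in power_types.
Proof.
case/setIP=> /mem_GLss ssx /mem_GLpow[y def_x]; rewrite inE; apply/andP; split.
  apply/eqP; rewrite -[RHS]ssx; apply: eq_bigr => f _.
  by rewrite mult_type_nullity.
apply/forallP => f; rewrite mult_typeE def_x GLval_exp.
by apply: power_nullity => //; apply: Phi_polyP.
Qed.

Lemma mult_type_surj m : m \in power_types -> exists2 x, x \in X & mult_type x = m.
Proof.
rewrite inE => /andP[/eqP sum_m /forallP idx_m].
have [B [Bu nulB]] := power_realization r_pr idxP idx_m sum_m.
have [y def_y] := GL_lift Bu; exists (y ^+ (r ^ a))%g.
  rewrite inE; apply/andP; split; last by apply/mem_GLpow; exists y.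
  apply/mem_GLss; rewrite GLval_exp def_y -[RHS]sum_m.
  by apply: eq_bigr => f _; apply: nulB.
apply/ffunP => f; apply/val_inj; rewrite /= mult_typeE GLval_exp def_y.
by rewrite /mult nulB mulKn //; apply/deg_Phi_gt0/Phi_polyP.
Qed.

Lemma mult_type_classE x y : x \in X ->
  (mult_type x == mult_type y) = ((x ^: G)%g == (y ^: G)%g).
Proof.
case/setIP=> /mem_GLss ssx _; apply/eqP/eqP => [eq_xy | eq_xy].
  have [f | P [Pu AP]] := @ss_conjugate _ _ (GLval x) (GLval y) ssx.
    by rewrite !mult_type_nullity eq_xy.
  have [z def_z] := GL_lift Pu; apply/esym/class_eqP/imsetP; exists z; rewrite ?inE //.
  apply: (mulgI z); rewrite -conjgC; apply: GLval_inj.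
  by rewrite !GL_ME def_z; apply/esym.
have /imsetP[z _ def_x] : x \in (y ^: G)%g by rewrite -eq_xy class_refl.
apply/ffunP => f; apply/val_inj; rewrite /= !mult_typeE /mult.
congr (_ %/ _)%N; apply/esym.
apply: (@nullity_intertwine _ _ _ _ (GLval z)); first exact: (GL_unit z).
by rewrite def_x -[LHS]GL_ME -[RHS]GL_ME conjgC.
Qed.

Lemma GLpow_ss_class x y : x \in X -> y \in (x ^: G)%g -> y \in X.
Proof.
move=> Xx yx; have eq_xy : (x ^: G = y ^: G)%g by apply/esym/class_eqP.
have /eqP eq_t : mult_type x == mult_type y by rewrite mult_type_classE ?eq_xy.
case/setIP: Xx => /mem_GLss ssx /mem_GLpow[z def_x].
apply/setIP; split.
  apply/mem_GLss; rewrite -[RHS]ssx; apply: eq_bigr => f _.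
  by rewrite !mult_type_nullity eq_t.
case/imsetP: yx => w _ ->; apply/mem_GLpow; exists (z ^ w)%g.
by rewrite def_x conjXg.
Qed.

Lemma mult_type_image : mult_type @: X = power_types.
Proof.
apply/setP => m; apply/imsetP/idP => [[x Xx ->] | /mult_type_surj[x Xx <-]].
  exact: mult_type_in.
by exists x.
Qed.

Lemma c_ss_power_types : c_ss F n.+1 (r ^ a) = #|power_types|.
Proof.
rewrite -mult_type_image.
have -> : c_ss F n.+1 (r ^ a) = #|class^~ G @: X|.
  congr #|pred_of_set _|; apply/setP => C; rewrite inE; apply/and3P/imsetP.
    case=> /imsetP[x _ ->] ss_C pow_C; exists x => //.
    by rewrite inE (subsetP ss_C) ?(subsetP pow_C) ?class_refl.
  case=> x Xx ->; rewrite mem_classes ?inE //.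
  have sub y : y \in (x ^: G)%g -> (y \in GLss F n.+1) && (y \in GLpow F n.+1 (r ^ a)).
    by move/(GLpow_ss_class Xx); rewrite inE.
  by split=> //; apply/subsetP => y /sub /andP[].
have reprX C : C \in class^~ G @: X -> repr C \in X /\ C = (repr C ^: G)%g.
  case/imsetP=> x Xx ->; have rx := mem_repr x (class_refl G x).
  split; first exact: GLpow_ss_class rx.
  by apply/esym/class_eqP.
rewrite -(card_in_imset (f := mult_type \o repr)); last first.
  move=> C D /reprX[XC ->] /reprX[XD ->] /= eqCD; apply/eqP.
  move/eqP: eqCD; rewrite mult_type_classE //.
    by have [_ <-] := reprX _ (imset_f _ XC); have [_ <-] := reprX _ (imset_f _ XD).
  by have [] := reprX _ (imset_f (class^~ G) XC).
congr #|pred_of_set _|; apply/setP => m; apply/imsetP/imsetP => [[C] | [x Xx ->]].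
  by move=> /reprX[XC _] ->; exists (repr C).
exists (x ^: G)%g; first exact: imset_f.
have [Xr eq_r] := reprX _ (imset_f (class^~ G) Xx).
by apply/eqP; rewrite /= mult_type_classE // -eq_r.
Qed.

(** The order of [GL(m, q ^ d)]. *)
Definition count_GL (q d m : nat) : nat := (\prod_(t < m) (q ^ (d * m) - q ^ (d * t)))%N.

Lemma card_cent_GL x : x \in X ->
  #|'C_G[x]%g| = (\prod_(f : Phi_le F n.+1) count_GL #|F| (deg f) (mult_type x f))%N.
Proof.
case/setIP=> /mem_GLss ssx _; set A := GLval x.
have frA := primary_list_frames (fun f : Phi_le F n.+1 => erefl (nullity A f)).
transitivity (size (frames A (primary_list A))).
  rewrite -(card_centralizer (@primary_list_irr _ _ A) frA (primary_list_deg ssx)).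
  rewrite -(card_imset _ GLval_inj); congr #|pred_of_set _|; apply/setP => P.
  apply/imsetP/idP => [[y] | ].
    case/setIP=> _ /cent1P xy ->; rewrite inE (GL_unit y) /=.
    by apply/eqP; have := congr1 (@GLval _ _) xy; rewrite !GL_ME => /esym.
  rewrite inE => /andP[/GL_lift[y <-] /eqP Ay]; exists y => //.
  apply/setIP; split; first exact: in_setT.
  apply/cent1P; apply: GLval_inj.
  by rewrite !GL_ME; apply/esym.
rewrite size_frames_prod; last by move=> g /mem_multilist[f [_ ->]]; exists f.
apply: eq_bigr => f _; rewrite count_multilist; last exact: Phi_poly_inj.
by rewrite /= -mult_typeE mult_type_nullity.
Qed.

(** The elements with multiplicities [m] form one class, whose proportion is the
   inverse of the order of a centralizer. *)
Lemma card_GLpow_ss : #|X|%:R / #|G|%:R =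
  \sum_(m in power_types) \prod_(f : Phi_le F n.+1)
     (count_GL #|F| (deg f) (m f))%:R^-1 :> rat.
Proof.
have -> : #|X| = (\sum_(m in power_types) #|[set x in X | mult_type x == m]|)%N.
  rewrite -sum1_card (partition_big mult_type (mem power_types)) => [|x].
    by apply: eq_bigr => m _; rewrite -sum1_card; apply: eq_bigl => x; rewrite inE.
  exact: mult_type_in.
rewrite natr_sum mulr_suml; apply: eq_bigr => m /mult_type_surj[x Xx <-].
have -> : [set y in X | mult_type y == mult_type x] = (x ^: G)%g.
  apply/setP => y; rewrite inE; apply/andP/idP => [[Xy]|xy].
    by rewrite mult_type_classE // => /eqP <-; apply: class_refl.
  have Xy := GLpow_ss_class Xx xy; split=> //.
  by rewrite mult_type_classE //; apply/eqP/class_eqP.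
rewrite -index_cent1 -(Lagrange (subsetIl G 'C[x]%g)) prodfV -natr_prod -card_cent_GL //.
rewrite natrM invfM mulrCA mulfV ?mulr1 // Num.Theory.pnatr_eq0 -lt0n.
exact: indexg_gt0.
Qed.

End Classes.

(** * Products of formal power series *)

Section PowerSeries.
Variable R : fieldType.
Implicit Types f g : fps R.

(** Congruence modulo [u ^ n.+1]. *)
Definition eqmod_fps n f g := forall k, (k <= n)%N -> coefs f k = coefs g k.

Lemma eqmod_fpsM n f f' g g' :
  eqmod_fps n f f' -> eqmod_fps n g g' -> eqmod_fps n (f * g) (f' * g').
Proof.
move=> ff' gg' k le_kn; rewrite !coefsM; apply: eq_bigr => i _.
rewrite ff' ?gg' //; first exact: leq_trans (leq_subr _ _) le_kn.
by apply: leq_trans le_kn; rewrite -ltnS ltn_ord.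
Qed.

Lemma eqmod_fps_prod n I (s : seq I) (P : pred I) (f g : I -> fps R) :
  (forall i, P i -> eqmod_fps n (f i) (g i)) ->
  eqmod_fps n (\prod_(i <- s | P i) f i) (\prod_(i <- s | P i) g i).
Proof.
move=> fg; elim/big_rec2: _ => // i f' g' Pi fg'; apply: eqmod_fpsM => //.
exact: fg.
Qed.

Lemma eqmod_fps1X n f m : eqmod_fps n f 1 -> eqmod_fps n (f ^+ m) 1.
Proof.
move=> f1; elim: m => // m IHm; rewrite exprS -[X in eqmod_fps _ _ X]mulr1.
exact: eqmod_fpsM.
Qed.

Lemma eq_fps_eq_prod a (F1 F2 : nat -> nat -> fps R) S :
  (forall i d, (0 < d)%N -> F1 i d = F2 i d) ->
  fps_eq_prod a F1 S -> fps_eq_prod a F2 S.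
Proof.
move=> eqF [P [hasP ->]]; exists P; split=> // i le_ia n.
have [D0 D0P] := hasP i le_ia n; exists D0 => D le_D; rewrite -(D0P D le_D).
congr (coefs _ n); apply: eq_big_nat => d /andP[d_gt0 _].
by rewrite eqF.
Qed.

(** As [Fs i d = 1] modulo [u ^ d], the partial products up to [n] determine the
   coefficient of [u ^ n]. *)
Lemma fps_eq_prod_coefs a (Fs : nat -> nat -> fps R) S :
  (forall i d, eqmod_fps d (Fs i d.+1) 1) ->
  (forall n, coefs S n =
     coefs (\prod_(0 <= i < a.+1) \prod_(1 <= d < n.+1) Fs i d) n) ->
  fps_eq_prod a Fs S.
Proof.
move=> F1 coefS; pose Q i D := \prod_(1 <= d < D.+1) Fs i d.
have stable i k D : (k <= D)%N -> coefs (Q i D) k = coefs (Q i k) k.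
  move=> le_kD; rewrite /Q (big_cat_nat (n := k.+1)) //=.
  rewrite -[X in _ = coefs X k]mulr1; apply: (@eqmod_fpsM k) => //.
  rewrite big_nat; elim/big_rec: _ => // d f /andP[lt_kd _] f1.
  rewrite -[X in eqmod_fps _ _ X]mulr1; apply: eqmod_fpsM => // l le_lk.
  case: d lt_kd => // d; rewrite ltnS => le_kd.
  by apply: F1; apply: leq_trans le_lk le_kd.
exists (fun i => FPS (fun n => coefs (Q i n) n)); split=> [i _ n | ].
  by exists n => D le_nD; apply: stable.
apply: fpsP => n; rewrite coefS; apply: (@eqmod_fps_prod n) => // i _ k le_kn /=.
exact: stable.
Qed.

Lemma coefs_fpsX_mul f k : coefs (fpsX R * f) k = if k is l.+1 then coefs f l else 0.
Proof.
rewrite coefsM; case: k => [|k]; first by rewrite big_ord1 mul0r.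
rewrite big_ord_recl mul0r add0r big_ord_recl /= mul1r subSS subn0 big1 ?addr0 //.
by move=> i _; rewrite mul0r.
Qed.

Lemma coefs_fpsXn m k : coefs (fpsX R ^+ m) k = (k == m)%:R.
Proof.
elim: m k => [|m IHm] k; first by rewrite expr0 coefs1.
by rewrite exprS coefs_fpsX_mul; case: k => // k; rewrite IHm eqSS.
Qed.

Lemma coefs_fpsXn_mul m f k :
  coefs (fpsX R ^+ m * f) k = if (m <= k)%N then coefs f (k - m) else 0.
Proof.
elim: m k => [|m IHm] k; first by rewrite mul1r subn0.
by rewrite exprS -mulrA coefs_fpsX_mul; case: k => // k; rewrite IHm.
Qed.

Lemma fpsCM (c d : R) : fpsC (c * d) = fpsC c * fpsC d.
Proof. by apply: fpsP => k; rewrite coefsCM /=; case: eqP; rewrite ?mulr0. Qed.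

Lemma fpsC1 : fpsC 1 = 1 :> fps R.
Proof. by apply: fpsP => -[]. Qed.

Lemma coefs_1_fps_sum1 e (c : nat -> R) k : (0 < e)%N ->
  coefs (1 + fps_sum1 e c) k =
    if (e %| k)%N then (if k == 0%N then 1 else c (k %/ e)%N) else 0.
Proof.
move=> e_gt0; rewrite coefsD coefs1 /=; case: k => [|k].
  by rewrite big_geq ?addr0 ?dvdn0.
rewrite add0r /=; case: dvdnP => [[j def_k] | ndvd]; last first.
  by rewrite big1 // => j /eqP def_k; case: ndvd; exists j; rewrite mulnC.
have j_gt0 : (0 < j)%N by case: j def_k.
have le_jk : (j < k.+2)%N by rewrite ltnS def_k leq_pmulr.
rewrite def_k mulnK // -def_k.
rewrite (eq_bigl (fun l => l == j)); last by move=> l; rewrite def_k mulnC eqn_pmul2r.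
by rewrite big_nat1_eq j_gt0 le_jk.
Qed.

Lemma inv_1_sub_fpsXn e : (0 < e)%N ->
  (1 - fpsX R ^+ e)^-1 = 1 + fps_sum1 e (fun=> 1).
Proof.
move=> e_gt0; apply: mulr1_eq; apply: fpsP => k.
rewrite mulrBl mul1r coefsB coefs_fpsXn_mul coefs1 !coefs_1_fps_sum1 //.
rewrite !if_same; have [lt_ke | le_ek] := leqP e k; last first.
  rewrite subr0; case: k le_ek => [|k] lt_ke; first by rewrite dvdn0.
  by rewrite gtnNdvd.
rewrite dvdn_subl // subrr gtn_eqF //; exact: leq_trans lt_ke.
Qed.

(** Modulo [u ^ n.+1] each factor is the polynomial [\sum_m h i m * u ^ (d i * m)] over
   [m <= n]; distributing the product over these sums gives a term for each family. *)
Lemma coefs_prod_family (I : finType) (d : I -> nat) (h : I -> nat -> R)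
    (H : I -> fps R) n :
  (forall i k, (k <= n)%N ->
     coefs (H i) k = \sum_(m < n.+1) h i m * (d i * m == k)%N%:R) ->
  coefs (\prod_i H i) n =
  \sum_(m : {ffun I -> 'I_n.+1} | (\sum_i d i * m i == n)%N) \prod_i h i (m i).
Proof.
move=> coefH.
pose H' i := \sum_(m < n.+1) fpsC (h i m) * fpsX R ^+ (d i * m).
have HH' i : eqmod_fps n (H i) (H' i).
  move=> k le_kn; rewrite coefH // coefs_sum; apply: eq_bigr => m _.
  by rewrite coefsCM coefs_fpsXn eq_sym.
rewrite (eqmod_fps_prod _ (fun i _ => HH' i)) // /H' bigA_distr_bigA coefs_sum.
rewrite [RHS]big_mkcond; apply: eq_bigr => m _ /=; rewrite big_split /=.
rewrite prodrXr.
have <- := big_morph _ fpsCM fpsC1 (index_enum I) xpredT (fun i => h i (m i)).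
rewrite -coefsM coefsCM coefs_fpsXn eq_sym.
by case: eqP; rewrite ?mulr1 ?mulr0.
Qed.

End PowerSeries.

(** * The two generating functions *)

Section GeneratingFunction.
Variables (F : finFieldType) (r a : nat).
Hypothesis r_pr : prime r.

Lemma Npow_card n (idx : Phi_le F n -> nat) i d : (d <= n)%N ->
  (forall f : Phi_le F n, power_type r a (idx f) f) ->
  Npow F r a i d = #|[set f : Phi_le F n | (idx f == i) && (deg f == d)]|.
Proof.
move=> le_dn idxP; rewrite /Npow !cardE.
set A := [set f : {poly_d.+1 F} | _]; set B := [set f : Phi_le F n | _].
rewrite -(size_map (@polyn F d.+1)) -[RHS](size_map (@Phi_poly F n)).
apply/perm_size/uniq_perm.
- by rewrite map_inj_uniq ?enum_uniq //; apply: val_inj.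
- by rewrite map_inj_uniq ?enum_uniq //; apply: Phi_poly_inj.
move=> f; apply/mapP/mapP => [[f' + ->] | [f' + ->]].
  rewrite mem_enum inE => /asboolP[Pf szf tyf].
  have [|f'' def_f] := @Phi_poly_surj F n f' Pf; first by rewrite szf ltnS.
  exists f''; rewrite // mem_enum inE def_f szf eqxx andbT; apply/eqP.
  have Pf'' := Phi_polyP f''; apply: (power_type_uniq r_pr Pf'' (idxP f'')).
  by rewrite def_f /power_type szf.
rewrite mem_enum inE => /andP[/eqP idx_f /eqP deg_f].
have Pf := Phi_polyP f'; have [_ [f1 _] _] := Pf.
have szf : size (Phi_poly f') = d.+1 by rewrite -deg_f (ltn_predK f1).
have szf' : (size (Phi_poly f') <= d.+1)%N by rewrite szf.
exists (NPoly szf') => //; rewrite mem_enum inE; apply/asboolP; split=> //.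
by have := idxP f'; rewrite idx_f /power_type szf.
Qed.

Lemma prod_Npow n (idx : Phi_le F n -> nat) (H : nat -> nat -> fps rat) :
  (forall f : Phi_le F n, power_type r a (idx f) f) ->
  (forall f : Phi_le F n, idx f <= a)%N ->
  \prod_(0 <= i < a.+1) \prod_(1 <= d < n.+1) H i d ^+ Npow F r a i d
    = \prod_(f : Phi_le F n) H (idx f) (deg f).
Proof.
move=> idxP idx_le.
transitivity (\prod_(0 <= i < a.+1) \prod_(1 <= d < n.+1) \prod_(f : Phi_le F n)
    if (idx f == i) && (deg f == d) then H i d else 1).
  apply: eq_bigr => i _; apply: eq_big_nat => d /andP[_ le_dn].
  rewrite (Npow_card _ _ idxP) // -prodr_const big_mkcond /=.
  by apply: eq_bigr => f _; rewrite inE.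
under eq_bigr do rewrite exchange_big.
rewrite exchange_big; apply: eq_bigr => f _.
have d_gt0 := deg_Phi_gt0 (Phi_polyP f).
have le_d : (deg (Phi_poly f) <= n)%N.
  by have := size_Phi_poly f; rewrite -[X in (X <= _)%N]prednK // ltnW // -subn_gt0 subn1.
rewrite -[RHS]/(if true then H (idx f) (deg (Phi_poly f)) else 1).
transitivity (\prod_(0 <= i < a.+1 | i == idx f)
    \prod_(1 <= d < n.+1 | d == deg (Phi_poly f)) H i d).
  rewrite [RHS]big_mkcond; apply: eq_bigr => i _.
  rewrite [in RHS]big_mkcond [idx f == i]eq_sym; case: eqP => _ /=; last by rewrite big1.
  by apply: eq_bigr => d _; rewrite eq_sym.
by rewrite big_nat1_eq /= ltnS idx_le big_nat1_eq d_gt0 ltnS le_d.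
Qed.

Lemma sum_dvdn_coef (h : nat -> rat) n d k : (0 < d)%N -> (k <= n)%N ->
  \sum_(m < n.+1) h m * (d * m == k)%N%:R = if (d %| k)%N then h (k %/ d)%N else 0.
Proof.
move=> d_gt0 le_kn; case: dvdnP => [[j def_k] | ndvd]; last first.
  rewrite big1 // => m _; case: eqP => [def_k|]; last by rewrite mulr0.
  by case: ndvd; exists m; rewrite mulnC.
have lt_jn : (j < n.+1)%N by rewrite ltnS (leq_trans _ le_kn) // def_k leq_pmulr.
rewrite (bigD1 (Ordinal lt_jn)) //= def_k [(j * d)%N]mulnC eqxx mulr1 mulKn //.
rewrite big1 ?addr0 //.
move=> m; rewrite -val_eqE /= => neq_mj.
by rewrite eqn_pmul2l // (negPf neq_mj) mulr0.
Qed.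

(** The common form of the two identities: [g d m] is the weight of [m] copies of
   [F[x] / (f)] with [f] of degree [d], namely [1] when classes are counted and the
   inverse of the order of [GL(m, q ^ d)] when elements are. *)
Lemma fps_eq_prod_power_types (g : nat -> nat -> rat) (S : fps rat) :
  (forall d, g d 0%N = 1) -> coefs S 0 = 1 ->
  (forall n (idx : Phi_le F n.+1 -> nat),
     (forall f : Phi_le F n.+1, power_type r a (idx f) f) ->
     coefs S n.+1 = \sum_(m in power_types r idx)
       \prod_(f : Phi_le F n.+1) g (deg (Phi_poly f)) (m f)) ->
  fps_eq_prod a (fun i d =>
    (1 + fps_sum1 (r ^ i * d) (fun j => g d (r ^ i * j)%N)) ^+ Npow F r a i d) S.
Proof.
move=> g0 S0 coefS; set H := fun i d => _.
have ri_gt0 i : (0 < r ^ i)%N by rewrite expn_gt0 prime_gt0.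
apply: fps_eq_prod_coefs => [i d | [|n]].
- apply: eqmod_fps1X => k le_kd.
  rewrite coefs_1_fps_sum1 ?muln_gt0 ?ri_gt0 // coefs1.
  case: k le_kd => [|k] lt_kd; first by rewrite dvdn0.
  by rewrite gtnNdvd // (leq_ltn_trans lt_kd) // leq_pmull.
- rewrite S0 big1 ?coefs1 // => i _; by rewrite big_geq.
have /boolp.choice[idx idxP'] (f : Phi_le F n.+1) :
    exists i, (i <= a)%N /\ power_type r a i f.
  exact/power_type_exists/Phi_polyP.
have idxP (f : Phi_le F n.+1) : power_type r a (idx f) f by case: (idxP' f).
have idx_le (f : Phi_le F n.+1) : (idx f <= a)%N by case: (idxP' f).
rewrite (coefS n idx idxP) (prod_Npow
  (fun i d => 1 + fps_sum1 (r ^ i * d) (fun j => g d (r ^ i * j)%N)) idxP idx_le).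
pose h (f : Phi_le F n.+1) (m : nat) :=
  if (r ^ idx f %| m)%N then g (deg (Phi_poly f)) m else 0.
rewrite (@coefs_prod_family _ _ (fun f : Phi_le F n.+1 => deg (Phi_poly f)) h); last first.
  move=> f k le_kn; have d_gt0 := deg_Phi_gt0 (Phi_polyP f).
  rewrite sum_dvdn_coef // coefs_1_fps_sum1 ?muln_gt0 ?ri_gt0 // /h.
  have [/dvdnP[j ->] | ndvd] := boolP (deg (Phi_poly f) %| k)%N; last first.
    by rewrite ifN //; apply: contra ndvd; apply: dvdn_trans; apply: dvdn_mull.
  rewrite dvdn_pmul2r // mulnK // muln_eq0 orbC gtn_eqF //=.
  have [/dvdnP[l ->] | //] := boolP (r ^ idx f %| j)%N.
  rewrite -mulnA mulnK ?muln_gt0 ?ri_gt0 // muln_eq0 orbC gtn_eqF //= mulnC.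
  by case: l => [|l] //=; rewrite muln0 g0.
rewrite [LHS]big_mkcond [RHS]big_mkcond; apply: eq_bigr => m _.
rewrite inE; case: eqP => //= _; case: forallP => [all_r | not_r].
  by apply: eq_bigr => f _; rewrite /h all_r.
have /existsP[f nf] : [exists f : Phi_le F n.+1, ~~ (r ^ idx f %| m f)%N].
  by rewrite -negb_forall; apply/negP => /forallP.
by rewrite (bigD1 f) //= /h (negPf nf) mul0r.
Qed.

Lemma count_GLE (q d m : nat) : (0 < q)%N ->
  (count_GL q d m)%:R = q%:R ^+ (m * (m - 1) * d)./2
    * \prod_(1 <= t < m.+1) (q%:R ^+ (t * d) - 1) :> rat.
Proof.
move=> q_gt0; rewrite /count_GL.
have -> : ((m * (m - 1) * d)./2 = \sum_(0 <= t < m) d * t)%N.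
  have -> : (m * (m - 1) = 'C(m, 2).*2)%N.
    rewrite subn1 bin2 -[LHS]odd_double_half oddM.
    by case: (m) => // k; rewrite /= andNb.
  by rewrite -big_distrr /= bin2_sum -doubleMl doubleK mulnC.
(* The factor with index [t] on the left is [q ^ (d t) (q ^ (d (m - t)) - 1)]. *)
rewrite natr_prod expr_sum big_mkord big_add1 /= big_mkord.
rewrite [X in _ * X](reindex_inj rev_ord_inj) -big_split /=; apply: eq_bigr => t _.
have lt_tm : (t < m)%N by [].
rewrite natrB; last by rewrite leq_pexp2l // leq_mul2l (ltnW lt_tm) orbT.
rewrite !natrX mulrBr mulr1 -exprD subnSK // mulnC; congr (_ ^+ _ - _).
by rewrite [(d * t)%N]mulnC -mulnDl subnKC ?(ltnW lt_tm).
Qed.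

End GeneratingFunction.

Theorem theorem6p2 (F : finFieldType) (r a : nat)
    (r_prime : prime r) (a_gt0 : (0 < a)%N)
    (coprime_q_M : coprime #|F| (r ^ a)) :
  fps_eq_prod a
    (fun i d => (1 - fpsX rat ^+ (r ^ i * d)) ^- Npow F r a i d)
    (1 + fps_sum1 1 (fun n => (c_ss F n (r ^ a))%:R))
  /\
  fps_eq_prod a
    (fun i d =>
       (1 + fps_sum1 (r ^ i * d) (fun j =>
          let m := (r ^ i * j)%N in
          (#|F|%:R ^+ (m * (m - 1) * d)./2
             * \prod_(1 <= t < m.+1) (#|F|%:R ^+ (t * d) - 1))^-1))
       ^+ Npow F r a i d)
    (1 + fps_sum1 1 (fun n =>
       #|GLpow_ss F n (r ^ a)|%:R / #|'GL_n[F]%g|%:R : rat)).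
Proof.
have coef0 c : coefs (1 + fps_sum1 1 c : fps rat) 0 = 1.
  by rewrite coefs_1_fps_sum1.
have coefS c n : coefs (1 + fps_sum1 1 c : fps rat) n.+1 = c n.+1.
  by rewrite coefs_1_fps_sum1 // dvd1n divn1.
have ri_gt0 i : (0 < r ^ i)%N by rewrite expn_gt0 prime_gt0.
have q_gt0 : (0 < #|F|)%N by rewrite ltnW ?finNzRing_gt1.
split.
  apply: (@eq_fps_eq_prod _ _ (fun i d =>
      (1 + fps_sum1 (r ^ i * d) (fun=> 1)) ^+ Npow F r a i d)).
    by move=> i d d_gt0; rewrite -exprVn inv_1_sub_fpsXn // muln_gt0 ri_gt0.
  apply: (@fps_eq_prod_power_types _ _ _ r_prime (fun _ _ => 1)) => // n idx idxP.
  rewrite coefS (c_ss_power_types r_prime coprime_q_M idxP) -sum1_card natr_sum.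
  by apply: eq_bigr => m _; rewrite big1_eq.
apply: (@eq_fps_eq_prod _ _ (fun i d => (1 + fps_sum1 (r ^ i * d)
    (fun j => (count_GL #|F| d (r ^ i * j)%N)%:R^-1)) ^+ Npow F r a i d)).
  move=> i d _; congr ((1 + _) ^+ _); apply: fpsP => k /=.
  by apply: eq_bigr => j _; rewrite count_GLE.
apply: (@fps_eq_prod_power_types _ _ _ r_prime
    (fun d m => (count_GL #|F| d m)%:R^-1)) => //.
  by move=> d; rewrite /count_GL big_ord0 invr1.
by move=> n idx idxP; rewrite coefS (card_GLpow_ss r_prime coprime_q_M idxP).
Qed.
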